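(* Let $L,\varepsilon_1,\varepsilon_2,\delta>0$ and $\boldsymbol{x}\in\mathbb{R}^n$ be arbitrary, and let $f:\mathbb{R}^n\to\mathbb{R}$ be $L$-smooth. Put $\varepsilon_g:=\varepsilon_1/3$, $\varepsilon_H:=\varepsilon_2$ and $\sigma:=\min\{\delta,\varepsilon_1/(3L)\}$. If $\|\nabla f_\sigma(\boldsymbol{x})\|\le\varepsilon_g$ and $\lambda_{\min}(\nabla^2f_\sigma(\boldsymbol{x}))\ge-\varepsilon_H$, then $$\|\nabla f(\boldsymbol{x})\|\le\varepsilon_1\quad\text{and}\quad\min_{\boldsymbol{w}\in\mathbb{S}^n}\ \max_{\boldsymbol{A}\in\partial_\delta^2f(\boldsymbol{x})}\langle\boldsymbol{A}\boldsymbol{w},\boldsymbol{w}\rangle\ge-\varepsilon_2.$$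
   Context: $\|\cdot\|$ is the Euclidean norm; $\mathbb{B}^n$ is the closed unit ball and $\mathbb{S}^n=\{\boldsymbol{w}\in\mathbb{R}^n:\|\boldsymbol{w}\|=1\}$; $\lambda_{\min}$ is the smallest eigenvalue of a symmetric matrix. A function is $L$-smooth if it is differentiable with $L$-Lipschitz gradient. For $\sigma>0$, $f_\sigma(\boldsymbol{x}):=\mathbb{E}_{\boldsymbol{u}\sim\operatorname{Unif}(\mathbb{B}^n)}[f(\boldsymbol{x}+\sigma\boldsymbol{u})]$ (twice differentiable when $f$ is $L$-smooth). The Clarke generalized Hessian $\partial_{\mathrm C}^2f(\boldsymbol{x})$ is the convex hull of all limits $\lim_k\nabla^2f(\boldsymbol{y}_k)$ along sequences $\boldsymbol{y}_k\to\boldsymbol{x}$ of points at which $f$ is twice differentiable. The Goldstein generalized Hessian is $\partial_\delta^2f(\boldsymbol{x}):=\operatorname{conv}\big(\bigcup_{\boldsymbol{y}\in\boldsymbol{x}+\delta\mathbb{B}^n}\partial_{\mathrm C}^2f(\boldsymbol{y})\big)$. *)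

(* Defs.v *)
From HB Require Import structures.
From mathcomp Require Import all_boot all_order all_algebra.
From mathcomp Require Import all_classical all_reals all_analysis measurable_realfun.

Set Implicit Arguments.
Unset Strict Implicit.
Unset Printing Implicit Defensive.

Import Order.TTheory GRing.Theory Num.Theory.
Import numFieldNormedType.Exports.

Local Open Scope classical_set_scope.
Local Open Scope ring_scope.

(* Points of R^n are row vectors. The library norm on 'rV[R]_n is the sup norm,
   so the Euclidean structure is introduced here; both norms induce the same
   topology, hence the same notions of limit and differentiability. *)
Section euclidean.
Variables (R : realType) (n : nat).
Implicit Types u v x w : 'rV[R]_n.

Definition dot u v : R := \sum_i u 0 i * v 0 i.

Definition enorm u : R := Num.sqrt (dot u u).

Definition eball x (r : R) : set 'rV[R]_n := [set y | enorm (y - x) <= r].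

Definition esphere : set 'rV[R]_n := [set w | enorm w = 1].

(* <A w, w>; for a row vector w, the vector A w is w *m A^T. *)
Definition quad (A : 'M[R]_n) w : R := dot (w *m A^T) w.

(* The set of eigenvalues of a real symmetric matrix of size n > 0 is finite
   and nonempty, so that its infimum is the smallest eigenvalue. *)
Definition lambda_min (A : 'M[R]_n) : R := inf [set a | eigenvalue A a].

End euclidean.

Arguments esphere : clear implicits.

Section extrema.
Variable R : realType.

Definition is_max (S : set R) (m : R) := S m /\ ubound S m.

Definition is_min (S : set R) (m : R) := S m /\ lbound S m.

End extrema.

Section calculus.
Variables (R : realType) (n : nat).
Implicit Types (f : 'rV[R]_n -> R) (x : 'rV[R]_n).

Definition grad f x : 'rV[R]_n := \row_i 'D_(delta_mx 0 i) f x.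

Definition hess f x : 'M[R]_n := jacobian (grad f) x.

Definition twice_differentiable f x :=
  (\forall y \near x, differentiable f y) /\ differentiable (grad f) x.

Definition smooth (L : R) f :=
  (forall x, differentiable f x) /\
  (forall x y, enorm (grad f x - grad f y) <= L * enorm (x - y)).

Definition limiting_hessians f x : set 'M[R]_n :=
  [set H | exists y : nat -> 'rV[R]_n,
    [/\ forall k, twice_differentiable f (y k),
        y k @[k --> \oo] --> x &
        hess f (y k) @[k --> \oo] --> H]].

Definition conv_hull (S : set 'M[R]_n) : set 'M[R]_n :=
  smallest (@convex_set R 'M[R]_n) S.

Definition clarke_hessian f x : set 'M[R]_n := conv_hull (limiting_hessians f x).

Definition goldstein_hessian (delta : R) f x : set 'M[R]_n :=
  conv_hull (\bigcup_(y in eball x delta) clarke_hessian f y).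

End calculus.

(* n-dimensional Lebesgue measure, by iterating the product of measures. It is
   carried by n.-tuple R, which the library equips with the sigma-algebra
   generated by the coordinates, i.e. the Borel sigma-algebra of R^n. *)
Section measure_cons.
Variables (R : realType) (n : nat).
Local Notation T := (measurableTypeR R).
Variable nu : {sigma_finite_measure set T -> \bar R}.
Variable mu : {sigma_finite_measure set (n.-tuple T) -> \bar R}.

Definition tcons (p : T * n.-tuple T) : n.+1.-tuple T :=
  [the n.+1.-tuple T of p.1 :: p.2].

Lemma measurable_tcons : measurable_fun [set: T * n.-tuple T] tcons.
Proof. exact: measurable_cons. Qed.

Definition measure_cons : set (n.+1.-tuple T) -> \bar R :=
  pushforward (nu \x mu)%E tcons.

Let measure_cons0 : measure_cons set0 = 0%E.
Proof. by rewrite /measure_cons /pushforward preimage_set0 measure0. Qed.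

Let measure_cons_ge0 A : (0 <= measure_cons A)%E.
Proof. by rewrite /measure_cons /pushforward; exact: measure_ge0. Qed.

Let measure_cons_sigma_additive : semi_sigma_additive measure_cons.
Proof.
move=> F mF tF mUF; rewrite /measure_cons /pushforward preimage_bigcup.
apply: measure_semi_sigma_additive.
- by move=> k; rewrite -[X in measurable X]setTI; exact: measurable_tcons.
- apply/trivIsetP => /= i j _ _ ij; rewrite -preimage_setI.
  by move/trivIsetP : tF => /(_ _ _ _ _ ij) ->//; rewrite preimage_set0.
- by rewrite -preimage_bigcup -[X in measurable X]setTI; exact: measurable_tcons.
Qed.

HB.instance Definition _ := isMeasure.Build _ _ _ measure_cons
  measure_cons0 measure_cons_ge0 measure_cons_sigma_additive.

Let measure_cons_sigma_finite : sigma_finite setT measure_cons.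
Proof.
have /sigma_finiteP[F [TF ndF Foo]] := sigma_finiteT nu.
have /sigma_finiteP[G [TG ndG Goo]] := sigma_finiteT mu.
pose g (t : n.+1.-tuple T) : T * n.-tuple T :=
  (tnth t ord0, [tuple of behead t]).
have gK : cancel tcons g.
  by move=> [a t]; rewrite /g /tcons/=; congr pair; apply/val_inj.
have mg : measurable_fun [set: n.+1.-tuple T] g.
  apply/measurable_fun_pair; first exact: measurable_tnth.
  exact: measurable_behead.
exists (fun k => g @^-1` (F k `*` G k)).
  apply/esym/seteqP; split => // t _.
  have [i _ Fi] : (\bigcup_k F k) (g t).1 by rewrite -TF.
  have [j _ Gj] : (\bigcup_k G k) (g t).2 by rewrite -TG.
  exists (maxn i j) => //; split.
  - by move: Fi; exact/subsetPset/ndF/leq_maxl.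
  - by move: Gj; exact/subsetPset/ndG/leq_maxr.
move=> k; have [mF Fk] := Foo k; have [mG Gk] := Goo k; split.
  by rewrite -[X in measurable X]setTI; apply: mg => //; exact: measurableX.
rewrite /measure_cons /pushforward (_ : _ @^-1` _ = F k `*` G k); last first.
  by apply/seteqP; split => z; rewrite /preimage /mkset gK.
by rewrite product_measure1E// lte_mul_pinfty// ge0_fin_numE.
Qed.

HB.instance Definition _ := Measure_isSigmaFinite.Build _ _ _ measure_cons
  measure_cons_sigma_finite.

End measure_cons.

Fixpoint lebesgue_tuple (R : realType) (n : nat) :
    {sigma_finite_measure set (n.-tuple (measurableTypeR R)) -> \bar R} :=
  match n with
  | 0 => [the {sigma_finite_measure set _ -> \bar R} of dirac [tuple]]
  | n'.+1 =>
      [the {sigma_finite_measure set _ -> \bar R} of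
       measure_cons (@lebesgue_measure R) (lebesgue_tuple R n')]
  end.

Section smoothing.
Variables (R : realType) (n : nat).
Local Notation T := (n.-tuple (measurableTypeR R)).

Definition rV_of_tuple (t : T) : 'rV[R]_n := \row_i tnth t i.

Definition tuple_ball : set T := [set t | eball 0 1 (rV_of_tuple t)].

Lemma measurable_tuple_ball : measurable tuple_ball.
Proof.
pose q (t : T) : R := \sum_(i < n) tnth t i * tnth t i.
have mq : measurable_fun [set: T] q.
  by apply: measurable_sum => i; apply: measurable_funM; exact: measurable_tnth.
have -> : tuple_ball = q @^-1` [set r | r <= 1].
  have qE t : dot (rV_of_tuple t - 0) (rV_of_tuple t - 0) = q t.
    by rewrite subr0; apply: eq_bigr => i _; rewrite !mxE.
  have q_ge0 t : 0 <= q t by apply: sumr_ge0 => i _; rewrite -expr2 sqr_ge0.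
  apply/funext => t; apply/propext.
  by rewrite /tuple_ball /eball /enorm /preimage /mkset qE -{1}sqrtr1 ler_sqrt.
rewrite -[X in measurable X]setTI; apply: mq => //.
by rewrite -set_itvNyc; exact: measurable_itv.
Qed.

(* Lebesgue measure restricted to the unit ball and normalized; the Dirac
   measure is the default value required by [mnormalize], which is not used as
   the volume of the ball is positive and finite. *)
Definition unif_ball : probability T R :=
  [the probability T R of
   mnormalize (mrestr (lebesgue_tuple R n) measurable_tuple_ball)
              [the probability T R of dirac ([tuple of nseq n 0] : T)]].

Definition ball_smoothing (sigma : R) (f : 'rV[R]_n -> R) (x : 'rV[R]_n) : R :=
  fine 'E_unif_ball[fun u => f (x + sigma *: rV_of_tuple u)%R].

End smoothing.

(* Main.v *)
(* Every Hessian of [f] at a point of twice differentiability of the ball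
   [x + sigma B] belongs to the Goldstein Hessian. Since [grad f] is Lipschitz,
   Rademacher's theorem makes almost every point of the ball such a point, and
   by dominated convergence [f_sigma] is twice differentiable at [x] and its
   Hessian is the average of the Hessians of [f] on the ball. Hence for every
   unit [w] the maximum of [<A w, w>] over the Goldstein Hessian is at least
   [<hess f_sigma(x) w, w>], which is at least [lambda_min (hess f_sigma(x))].
   The gradient bound follows from
   [|grad f(x) - grad f_sigma(x)| <= L sigma <= eps1 / 3].

   Rademacher's theorem is proved one coordinate at a time. On a line, a
   Lipschitz function plus a linear one is nondecreasing, its Stieltjes measure
   has a Radon-Nikodym density, and Lebesgue differentiation applies. To pass
   from [k] to [k + 1] coordinates, cover almost all of the space by countably
   many closed sets on which [g] has first-order expansions, uniform in scale
   and error, along the first [k] coordinates and along the next axis. By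
   Lebesgue's density theorem and Fubini, almost every point [x] of such a
   closed set is not a porosity point along that axis, so that any small
   [x + t e] is close to a point of the set, where the two expansions can be
   chained. *)

Require Import Defs.
From HB Require Import structures.
From mathcomp Require Import all_boot all_order all_algebra.
From mathcomp Require Import all_classical all_reals all_analysis.
From mathcomp Require Import measurable_realfun lra ring.

Import Order.TTheory GRing.Theory Num.Theory.
Import numFieldNormedType.Exports.

Local Open Scope classical_set_scope.
Local Open Scope ring_scope.

Set Implicit Arguments.
Unset Strict Implicit.
Unset Printing Implicit Defensive.

(** * Almost everywhere derivability of Lipschitz functions on the line *)

Section lipschitz_derivable.
Variable R : realType.
Local Notation mu := (@lebesgue_measure R).

(** A null set has covers by half-open intervals of arbitrarily small total length, and [G]
    stretches lengths by at most [C]. Dividing by [C + 1] allows [C = 0]. *)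
Lemma stieltjes_null_dominates (G : cumulative R R) (C : R) : 0 <= C ->
  (forall a b, a <= b -> G b - G a <= C * (b - a)) ->
  lebesgue_stieltjes_measure G `<< mu.
Proof.
move=> C0 GC; apply/null_content_dominatesP => A mA A0.
apply/eqP; rewrite eq_le measure_ge0 andbT.
apply/lee_addgt0Pr => e e0; rewrite add0e.
have C1 : 0 < C + 1 by rewrite ltr_wpDl.
have eC : 0 < e / (C + 1) by rewrite divr_gt0.
have : (mu A : \bar R) \is a fin_num by rewrite A0.
move=> /(lb_ereal_inf_adherent eC)[_ /= [F FA <-]].
rewrite [X in (_ < X + _)%E -> _](_ : _ = mu A)// A0 add0e => Fe.
apply: (@le_trans _ _ (\sum_(k <oo) wlength G (F k))%E).
  by apply: ereal_inf_lbound; exists F.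
have wl k : (wlength G (F k) <= (C + 1)%:E * wlength idfun (F k))%E.
  have [mF _] := FA; have [x _ <-] := mF k.
  rewrite !wlength_itv; case: ifPn => //=; last by rewrite mule0.
  rewrite lte_fin => /ltW x12.
  rewrite -!EFinB -EFinM lee_fin (le_trans (GC _ _ x12))//.
  by rewrite ler_wpM2r ?subr_ge0// lerDl.
apply: (@le_trans _ _ (\sum_(k <oo) ((C + 1)%:E * wlength idfun (F k)))%E).
  by apply: lee_nneseries => // k _ *; exact: wlength_ge0.
rewrite nneseriesZl//.
have C1' : (0 <= (C + 1)%:E)%E by rewrite lee_fin ltW.
apply: (le_trans (lee_wpmul2l C1' (ltW Fe))).
by rewrite -EFinM mulrC divfK ?gt_eqF.
Qed.

(** By [stieltjes_null_dominates] and Radon-Nikodym, the Stieltjes measure of [G] has a density, so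
    that [G] is locally an indefinite integral up to a constant, and [FTC1] applies. *)
Lemma stieltjes_ae_derivable (G : cumulative R R) (C : R) : 0 <= C ->
  (forall a b, a <= b -> G b - G a <= C * (b - a)) ->
  {ae mu, forall t, derivable G t 1}.
Proof.
move=> C0 GC; have dom := stieltjes_null_dominates C0 GC.
pose nu := lebesgue_stieltjes_measure G.
(* On []- N, N]] the Stieltjes measure is finite, which makes its density integrable. *)
suff H (N : nat) : {ae mu, forall t, - N%:R < t < N%:R -> derivable G t 1}.
  have := ae_foralln H.
  apply: filterS => t /(_ (Num.bound `|t|)); apply.
  by rewrite -ltr_norml archi_boundP.
have G01 (a b : R) : a <= b -> nu `]a, b]%classic = (G b - G a)%:E.
  move=> ab; rewrite -(wlength_itv_bnd G false false ab) -measurable_mu_extE//.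
  exact: is_ocitv.
pose I : set (measurableTypeR R) := `]- N%:R, N%:R]%classic.
have mI : measurable I by exact: measurable_itv.
have nuoo : (nu I < +oo)%E.
  by rewrite /I G01 ?ltry//; have := ler0n R N; lra.
pose nuN : {finite_measure set _ -> \bar R} := mfrestr mI nuoo.
have domN : nuN `<< mu.
  apply/null_content_dominatesP => A mA A0.
  have /null_content_dominatesP := dom; apply.
    exact: measurableI.
  by apply: (subset_measure0 (B := A)) => //; exact: measurableI.
have [f [f0 ffin fint fE]] := radon_nikodym_sigma_finite domN.
pose g := fine \o f.
have gE : EFin \o g = f by apply/funext => t; rewrite /= fineK.
have gint (y : R) : mu.-integrable [set` Interval (BRight (- N%:R)) (BRight y)]
  (EFin \o g).
  rewrite gE; apply: integrableS fint => //.
have gloc : locally_integrable [set: R] g.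
  apply: open_integrable_locally => //; first exact: openT.
  by rewrite gE.
have := FTC1 gint gloc.
apply: filterS; first exact: (ae_filter_ringOfSetsType mu).
move=> t + /andP[Nt tN].
move=> /(_ Nt)[+ _].
set F := (X in derivable X); move=> dF.
(* [F] integrates the density from [- N]; adding [G (- N)] gives back [G] near [t]. *)
have dF' : derivable (fun x => F x + G (- N%:R)) t 1.
  by apply: derivableD => //; exact: derivable_cst.
apply: near_eq_derivable dF'.
near=> s; rewrite /F /Rintegral -[X in fine X](_ : nuN `]- N%:R, s]%classic = _);
  last first.
  by rewrite fE// -gE.
have Ns : - N%:R <= s by near: s; exact: lt_le_nbhsr.
have sN : s <= N%:R by near: s; exact: lt_le_nbhsl.
rewrite /nuN/= /mfrestr /mrestr setIidl.
  by rewrite [X in fine X](G01 _ _ Ns) /= subrK.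
by apply: subset_itvl; rewrite bnd_simp.
Unshelve. all: by end_near. Qed.

(** Adding [K * t] makes [g] nondecreasing with slopes at most [K + K]; the linear term is
    subtracted at the end. *)
Lemma lipschitz_ae_derivable (g : R -> R) (K : R) :
  (forall s t, `|g s - g t| <= K * `|s - t|) ->
  {ae mu, forall t, derivable g t 1}.
Proof.
move=> gK.
have K0 : 0 <= K by have := gK 1 0; rewrite subr0 normr1 mulr1; exact: le_trans.
pose G t := g t + K * t.
have GK a b : a <= b -> 0 <= G b - G a <= (K + K) * (b - a).
  move=> ab; have := gK b a; rewrite (ger0_norm (_ : 0 <= b - a)) ?subr_ge0//.
  by rewrite ler_norml /G => /andP[? ?]; apply/andP; split; lra.
have ndG : nondecreasing G.
  by move=> a b ab; rewrite -subr_ge0; have /andP[] := GK _ _ ab.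
have cG : continuous G.
  have GL s t : `|G t - G s| <= (K + K + 1) * `|t - s|.
    wlog ts : s t / s <= t.
      move=> h; have [|/ltW] := leP s t; first exact: h.
      by rewrite distrC (distrC t); exact: h.
    have /andP[h1 h2] := GK _ _ ts.
    rewrite !ger0_norm ?subr_ge0//; last by rewrite -subr_ge0.
    by rewrite (le_trans h2)// ler_wpM2r ?subr_ge0// lerDl.
  move=> t; apply/cvgrPdist_le => /= e e0; near=> s.
  rewrite (le_trans (GL _ _))// mulrC -ler_pdivlMr; last by rewrite !ltr_wpDl ?addr_ge0.
  near: s; apply: cvgr_dist_le; first exact: cvg_id.
  by rewrite divr_gt0// !ltr_wpDl ?addr_ge0.
pose Gc : cumulative R R := HB.pack G (isCumulative.Build R _ R G ndG
  (right_continuousW cG)).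
have := @stieltjes_ae_derivable Gc (K + K) (addr_ge0 K0 K0)
  (fun a b ab => (andP (GK a b ab)).2).
apply: filterS; first exact: (ae_filter_ringOfSetsType mu).
move=> t /= dG.
rewrite (_ : g = fun s => G s - K * s); last by apply/funext => s; rewrite /G addrK.
by apply: derivableB => //; exact: derivableM.
Unshelve. all: by end_near. Qed.

End lipschitz_derivable.

(** * Null sets of R^n by slicing *)

Section coordinate_slices.
Variable R : realType.
Local Notation mu := (@lebesgue_measure R).
Local Notation T n := (n.-tuple (measurableTypeR R)).

Definition tset n (t : T n) (i : 'I_n) (s : measurableTypeR R) : T n :=
  [tuple if j == i then s else tnth t j | j < n].

Lemma measurable_tset n (t : T n) i : measurable_fun setT (tset t i).
Proof.
apply/measurable_fun_tnthP => j.
rewrite (_ : _ \o _ = if j == i then id else cst (tnth t j)).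
  by case: ifP => _.
by apply/funext => s /=; rewrite tnth_mktuple; case: ifP.
Qed.

(** Tonelli by induction on [n]. Unless [i] is the first coordinate, the sections at a fixed first
    coordinate are null by induction. *)
Lemma lebesgue_tuple_slice_null n (N : set (T n)) (i : 'I_n) : measurable N ->
  (forall t, mu (tset t i @^-1` N) = 0%E) -> lebesgue_tuple R n N = 0%E.
Proof.
elim: n N i => [N [] //|n IHn N i mN sN0].
have mN' : measurable (@tcons R n @^-1` N).
  by rewrite -[X in measurable X]setTI; exact: measurable_tcons.
rewrite /= /measure_cons /pushforward.
case: (unliftP ord0 i) => [j|] iE; subst i.
  rewrite /product_measure1 integral0_eq//= => a _.
  apply: (IHn _ j) => [|t]; first exact: measurable_xsection.
  rewrite -[RHS](sN0 (tcons (a, t))); congr (mu _); apply/seteqP.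
  suff E s : tcons (a, tset t j s) = tset (tcons (a, t)) (lift ord0 j) s.
    by split => s /=; rewrite /xsection/= inE/= E.
  apply: eq_from_tnth => k; rewrite tnth_mktuple.
  case: (unliftP ord0 k) => [l|] ->; last by rewrite !tnth0.
  by rewrite !tnthS (inj_eq lift_inj) tnth_mktuple.
(* Slices along the first coordinate are the inner sets of the product taken in the other order, the
   same measure by uniqueness. *)
rewrite (_ : (_ \x _)%E _ = (mu \x^ lebesgue_tuple R n)%E (@tcons R n @^-1` N));
  last first.
  by apply: product_measure_unique => //= A B mA mB; rewrite product_measure2E.
rewrite /product_measure2 integral0_eq//= => t _.
rewrite -[RHS](sN0 (tcons (0, t))).
suff E s : tcons (s, t) = tset (tcons (0, t)) ord0 s.
  by congr (mu _); apply/funext => s; rewrite /ysection/= in_setE /= E.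
apply: eq_from_tnth => k; rewrite tnth_mktuple.
by case: (unliftP ord0 k) => [l|] ->; rewrite ?tnthS ?tnth0.
Qed.

(** Topology and calculus live on row vectors, Lebesgue measure on tuples; sets of row vectors are
    measured through [rV_of_tuple]. *)
Definition vmeasurable n (A : set 'rV[R]_n) :=
  measurable (@rV_of_tuple R n @^-1` A).

Definition vnegligible n (A : set 'rV[R]_n) :=
  (lebesgue_tuple R n).-negligible (@rV_of_tuple R n @^-1` A).

(** An open set is a countable union of balls with rational center and radius [1 / (k + 1)], and a
    ball of the sup norm is a product of intervals. *)
Lemma open_vmeasurable n (U : set 'rV[R]_n) : open U -> vmeasurable U.
Proof.
move=> oU.
pose c (q : 'rV[rat]_n) : 'rV[R]_n := map_mx ratr q.
pose B (p : 'rV[rat]_n * nat) : set 'rV[R]_n :=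
  if `[< ball (c p.1) p.2.+1%:R^-1 `<=` U >]
  then ball (c p.1) p.2.+1%:R^-1 else set0.
have -> : U = \bigcup_p B p.
  apply/seteqP; split => [x Ux|x [p _]]; last first.
    by rewrite /B; case: asboolP => // BU; exact: BU.
  have [e/= e0 xeU] := (nbhs_ballP x U).1 (open_nbhs_nbhs (conj oU Ux)).
  have [k /ltW ke] : exists k : nat, k.+1%:R^-1 < e / 2.
    have [k _ ke] := near_infty_natSinv_lt (PosNum (divr_gt0 e0 (ltr0n _ 2))).
    by exists k; exact: (ke k (leqnn k)).
  have k0 : 0 < k.+1%:R^-1 :> R by rewrite invr_gt0.
  have q i : {q : rat | ball (x 0 i) k.+1%:R^-1 (ratr q : R)}.
    apply: cid; have [|z [/= xz [q _ qz]]] :=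
        @dense_rat R (ball (x 0 i) k.+1%:R^-1) _ (ball_open _ _).
      by exists (x 0 i); exact: ballxx.
    by exists q; rewrite qz.
  exists (\row_i sval (q i), k) => //.
  have xq : ball (c (\row_i sval (q i))) k.+1%:R^-1 x.
    split => // i j; rewrite !mxE (ord1 i); apply: ball_sym; exact: svalP (q j).
  rewrite /B/=; case: asboolP => // -[] y qy; apply: xeU.
  rewrite (splitr e); apply: (ball_triangle (y := c (\row_i sval (q i)))).
    by apply: ball_sym; exact: le_ball xq.
  exact: le_ball qy.
rewrite /vmeasurable preimage_bigcup; apply: countable_bigcupT_measurable => // p.
rewrite /B; case: asboolP => _; last by rewrite preimage_set0.
have k0 : 0 < p.2.+1%:R^-1 :> R by rewrite invr_gt0.
rewrite (_ : _ @^-1` _ = \bigcap_(i in [set: 'I_n])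
  ((fun t : T n => tnth t i) @^-1`
    (ball (ratr (p.1 0 i) : R) p.2.+1%:R^-1 : set (measurableTypeR R)))).
  apply: fin_bigcap_measurable => // i _.
  rewrite -[X in measurable X]setTI; apply: measurable_tnth => //.
  exact: measurable_ball.
apply/seteqP; split => [t [_ h] i _|t h] /=.
  by have := h 0 i; rewrite !mxE.
by split => // i j; rewrite (ord1 i) !mxE; exact: (h j I).
Qed.

Lemma closed_vmeasurable n (A : set 'rV[R]_n) : closed A -> vmeasurable A.
Proof.
move=> cA; rewrite -(setCK A) /vmeasurable preimage_setC.
by apply: measurableC; apply: (@open_vmeasurable _ (~` A)); exact: closed_openC.
Qed.

Lemma vnegligible_slice n (A : set 'rV[R]_n) (i : 'I_n) : vmeasurable A ->
  (forall x, mu.-negligible [set s | A (x + s *: delta_mx 0 i)]) ->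
  vnegligible A.
Proof.
move=> mA sA0; apply/negligibleP => //.
apply: (lebesgue_tuple_slice_null (i := i)) => // t.
apply: measure_negligible.
  by rewrite -[X in measurable X]setTI; exact: measurable_tset.
(* With the [i]-th coordinate of the base point set to 0, moving by [s] along the axis sets it to
   [s]. *)
have := sA0 (rV_of_tuple (tset t i 0)); apply: negligibleS => s /=.
congr A; apply/rowP => j; rewrite !mxE !tnth_mktuple eqxx/=.
by case: ifP => _; rewrite ?mulr0 ?addr0// mulr1 add0r.
Qed.

Lemma measurable_continuous_rV n (f : 'rV[R]_n -> R) : continuous f ->
  measurable_fun setT (fun t : T n => f (rV_of_tuple t)).
Proof.
move=> cf; apply: (measurability _ (RGenOpens.measurableE R)) => //.
move=> _ [_ [a [b ->] <-]]; rewrite setTI.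
apply: (@open_vmeasurable _ (f @^-1` `]a, b[%classic)).
by apply: open_comp => [x _|]; [exact: cf|exact: interval_open].
Qed.

End coordinate_slices.

(** * Porosity and Lebesgue density on the line *)

Section porosity.
Variable R : realType.
Local Notation mu := (@lebesgue_measure R).

(* At such a point the gaps of relative size [c] keep the density of [C] below
   [1 - c / (1 + c)], so that it is not a Lebesgue density point of [C]. *)
Lemma porous_negligible (C : set R) (c : R) : 0 < c -> closed C ->
  mu.-negligible [set t | C t /\ forall i : nat, exists d, [/\ d != 0,
    `|d| < i.+1%:R^-1 & forall s, `|s - d| <= c * `|d| -> ~ C (t + s)]].
Proof.
move=> c0 cC; have mC : measurable C by exact: closed_measurable.
have := lebesgue_density mC; apply: negligibleS => t [Ct gaps].
rewrite /= indicE mem_set//= => dens.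
have q1 : (((1 + c)^-1)%:E < 1%:E :> \bar R)%E.
  by rewrite lte_fin invf_lt1 ?ltrDl// addr_gt0.
have : nbhs 1%:E [set x : \bar R | ((1 + c)^-1)%:E < x]%E.
  by apply: open_nbhs_nbhs; split => //; exact: open_ereal_gt_ereal.
move=> /dens; rewrite /nbhs/= => -[e/= e0 He].
have c1 : 0 < 1 + c by rewrite addr_gt0.
have [i ie] : exists i : nat, i.+1%:R^-1 < e / (1 + c).
  have [k _ ke] := near_infty_natSinv_lt (PosNum (divr_gt0 e0 c1)).
  by exists k; exact: (ke k (leqnn k)).
have [d [d0 di dC]] := gaps i.
(* The ball of radius [r] around [t] contains the gap of radius [c * |d|] around [t + d], so that
   [C] fills at most the fraction [1 / (1 + c)] of it. *)
pose r := (1 + c) * `|d|.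
have r0 : 0 < r by rewrite mulr_gt0// normr_gt0.
have : ball 0 e r.
  rewrite /ball/= sub0r normrN gtr0_norm// /r mulrC -ltr_pdivlMr//.
  exact: lt_trans ie.
move=> /He /(_ r0); apply/negP; rewrite -leNgt.
have r0' := ltW r0.
rewrite lebesgue_measure_ball//.
have cd0 : 0 < c * `|d| by rewrite mulr_gt0// normr_gt0.
have : (mu (C `&` ball t r) + mu (ball (t + d)%R (c * `|d|)%R) <= mu (ball t r))%E.
  rewrite -measureU//=; last 3 first.
  - by apply: measurableI => //; exact: measurable_ball.
  - exact: measurable_ball.
  - apply/seteqP; split => // s [[Cs _]]; rewrite /ball/= => sd.
    apply: (dC (s - t)); last by rewrite addrC subrK.
    by rewrite (_ : s - t - d = - (t + d - s)) ?normrN ?ltW//; ring.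
  apply: le_measure; rewrite ?inE.
  - apply: measurableU; last exact: measurable_ball.
    by apply: measurableI => //; exact: measurable_ball.
  - exact: measurable_ball.
  - move=> s [[]//|]; rewrite /ball/= => sd.
    rewrite (_ : t - s = (t + d - s) - d); last by ring.
    by rewrite (le_lt_trans (ler_normB _ _))// /r mulrDl mul1r addrC ltrD2l.
have cd0' := ltW cd0.
rewrite !lebesgue_measure_ball//.
have fin : mu (C `&` ball t r) \is a fin_num.
  rewrite ge0_fin_numE// (@le_lt_trans _ _ (mu (ball t r)))//.
    by apply: le_measure; rewrite ?inE; [apply: measurableI => //| |];
      [exact: measurable_ball..|exact: subIsetr].
  by rewrite lebesgue_measure_ball ?ltry.
rewrite -(fineK fin) -EFinD inver mulrn_eq0/= gt_eqF// -EFinM !lee_fin => h.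
rewrite ler_pdivrMr ?mulrn_wgt0// ler_pdivlMl// -[_ *+ 2]mulr_natr.
have aux (m a : R) : m + c * a * 2 <= (1 + c) * a * 2 -> (1 + c) * m <= (1 + c) * a * 2.
  by move=> h'; rewrite -mulrA ler_pM2l//; lra.
by apply: aux; rewrite !mulr_natr.
Qed.

End porosity.

(** * First-order expansions *)

Section frechet.
Variables (R : realType) (n : nat).
Implicit Types (g : 'rV[R]_n -> R) (x D h : 'rV[R]_n).

Lemma coord_le_norm m k (A : 'M[R]_(m, k)) i j : `|A i j| <= `|A|.
Proof.
rewrite [leRHS](mx_normrE A : `|A| = _).
by apply: (le_bigmax _ (fun ij => `|A ij.1 ij.2|) (i, j)).
Qed.

Lemma mx_norm_le m k (A : 'M[R]_(m, k)) (c : R) : 0 <= c ->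
  (forall i j, `|A i j| <= c) -> `|A| <= c.
Proof.
move=> c0 Ac; rewrite [leLHS](mx_normrE A : `|A| = _).
by apply/bigmax_leP; split.
Qed.

Lemma dotDl x y z : @dot R n (x + y) z = dot x z + dot y z.
Proof. by rewrite /dot -big_split; apply: eq_bigr => i _; rewrite mxE mulrDl. Qed.

Lemma dotC x y : @dot R n x y = dot y x.
Proof. by apply: eq_bigr => i _; rewrite mulrC. Qed.

Lemma dotDr x y z : @dot R n x (y + z) = dot x y + dot x z.
Proof. by rewrite dotC dotDl !(dotC x). Qed.

Lemma dotZl (a : R) x y : dot (a *: x) y = a * dot x y.
Proof. by rewrite /dot mulr_sumr; apply: eq_bigr => i _; rewrite mxE mulrA. Qed.

Lemma dotZr (a : R) x y : dot x (a *: y) = a * dot x y.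
Proof. by rewrite dotC dotZl dotC. Qed.

Lemma dotNl x y : dot (- x) y = - dot x y.
Proof. by rewrite -scaleN1r dotZl mulN1r. Qed.

Lemma dotNr x y : dot x (- y) = - dot x y.
Proof. by rewrite dotC dotNl dotC. Qed.

Lemma dotBl x y z : dot (x - y) z = dot x z - dot y z.
Proof. by rewrite dotDl dotNl. Qed.

Lemma dotBr x y z : dot x (y - z) = dot x y - dot x z.
Proof. by rewrite dotDr dotNr. Qed.

Lemma dot0r x : dot x 0 = 0.
Proof. by rewrite -(scale0r 0) dotZr mul0r. Qed.

Lemma dot0l x : dot 0 x = 0.
Proof. by rewrite dotC dot0r. Qed.

Lemma dot_delta x i : dot x (delta_mx 0 i) = x 0 i.
Proof.
rewrite /dot (bigD1 i)//= mxE !eqxx mulr1 big1 ?addr0// => j ji.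
by rewrite mxE eqxx (negbTE ji) mulr0.
Qed.

Lemma dot_le_norm x y : `|dot x y| <= n%:R * (`|x| * `|y|).
Proof.
rewrite (le_trans (ler_norm_sum _ _ _))//.
rewrite (le_trans (ler_sum _ (G := fun=> `|x| * `|y|) _))//.
  by move=> i _; rewrite normrM ler_pM ?coord_le_norm.
by rewrite sumr_const card_ord mulr_natl.
Qed.

Lemma dot_is_linear D : linear (dot D : 'rV[R]_n -> R^o).
Proof. by move=> a x y; rewrite dotDr dotZr. Qed.

HB.instance Definition _ D :=
  GRing.isLinear.Build R 'rV[R]_n R^o *:%R (dot D) (dot_is_linear D).

Lemma continuous_dot D : continuous (dot D).
Proof.
move=> x; apply/(@cvgrPdist_le _ _ _ (nbhs x)) => e e0; near=> y.
rewrite -dotBr (le_trans (dot_le_norm _ _))// mulrA.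
rewrite (@le_trans _ _ ((n%:R * `|D| + 1) * `|x - y|))//.
  by rewrite ler_wpM2r// lerDl.
rewrite mulrC -ler_pdivlMr ?ltr_wpDl ?mulr_ge0//.
near: y; apply: cvgr_dist_le; first exact: cvg_id.
by rewrite divr_gt0// ltr_wpDl ?mulr_ge0.
Unshelve. all: by end_near. Qed.

(** Kept in epsilon form, with an explicit gradient, so that expansions can be chained, estimated
    and averaged. *)
Definition frechet g x D := forall e, 0 < e ->
  \forall h \near (0 : 'rV[R]_n), `|g (x + h) - g x - dot D h| <= e * `|h|.

Lemma frechet_differentiable g x D : frechet g x D -> differentiable g x.
Proof.
move=> gD; apply/diffP.
(* ['d g x] is a chosen linear map with this property, so that exhibiting [dot D] is enough;
   [lim (nbhs x)] stands for [x]. *)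
apply: (@getPex _ (fun df : {linear 'rV[R]_n -> R^o} => continuous df /\
  forall y, g y = g (lim (nbhs x)) + df (y - lim (nbhs x))
                  +o_(y \near x) (y - lim (nbhs x)))).
pose df : {linear 'rV[R]_n -> R^o} := dot D.
exists df; split; first exact: continuous_dot.
have e0P e : 0 < e -> \forall y \near x,
    `|g y - (g (lim (nbhs x)) + df (y - lim (nbhs x)))| <= e * `|y - lim (nbhs x)|.
  move=> e0; rewrite lim_id//.
  rewrite (near_shift 0 x); apply: filterS (gD _ e0) => h /=.
  by rewrite subr0 addrK (addrC h) opprD addrA.
have : g = (fun y => g (lim (nbhs x)) + df (y - lim (nbhs x)))
    +o_ x (fun y => y - lim (nbhs x)) by apply/eqaddoP => e /e0P.
by rewrite funeqE.
Qed.

Lemma frechet_diff g x D : frechet g x D -> 'd g x = dot D :> ('rV[R]_n -> R).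
Proof.
move=> gD; pose df : {linear 'rV[R]_n -> R^o} := dot D.
apply: (diff_unique (df := df)); first exact: continuous_dot.
apply/eqaddoP => e e0; have := gD _ e0; apply: filterS => h.
by rewrite !fctE /= opprD addrA (addrC h).
Qed.

Lemma grad_dot g x h : differentiable g x -> 'd g x h = dot (grad g x) h.
Proof.
move=> dg; rewrite {1}(row_sum_delta h) linear_sum; apply: eq_bigr => i _.
by rewrite linearZ /= mxE deriveE// mulrC.
Qed.

Lemma differentiable_frechet g x : differentiable g x -> frechet g x (grad g x).
Proof.
move=> dg e e0; have /diff_locally/eqaddoP := dg => /(_ _ e0).
apply: filterS => h; rewrite !fctE/= grad_dot//.
by rewrite opprD addrA (addrC h).
Qed.

Lemma frechet_grad g x D : frechet g x D -> grad g x = D.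
Proof.
move=> gD; apply/rowP => i; rewrite mxE deriveE ?(frechet_diff gD) ?dot_delta//.
exact: frechet_differentiable gD.
Qed.

End frechet.

(** * Rademacher's theorem *)

Section porous_rV.
Variables (R : realType) (n : nat).
Implicit Types (C : set 'rV[R]_n) (x : 'rV[R]_n) (i : 'I_n).

(** The tube lemma: the segment of the admissible [s] is compact, and each [x + s *: e] lies in the
    open complement of [C]. *)
Lemma open_avoid C (e : 'rV[R]_n) (d r : R) : closed C ->
  open [set x | forall s : R, `|s - d| <= r -> ~ C (x + s *: e)].
Proof.
move=> cC; rewrite openE => x /= xC.
have /compact_near_coveringP cover : compact [set` `[d - r, d + r]].
  exact: segment_compact.
have H : forall s, [set` `[d - r, d + r]] s ->
    \forall s' \near s & x' \near nbhs x, ~ C (x' + s' *: e).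
  move=> s; rewrite /= in_itv/= -ler_distl => /xC sC.
  have : (fun p : R * 'rV[R]_n => p.2 + p.1 *: e) @ nbhs (s, x) --> x + s *: e.
    by apply: cvgD; [exact: cvg_snd|apply: cvgZr_tmp; exact: cvg_fst].
  move=> /(_ (~` C)); apply; apply: open_nbhs_nbhs.
  by split; [exact: closed_openC|].
have nx := cover _ (nbhs x) (fun x' s => ~ C (x' + s *: e)) (nbhs_filter x) H.
apply: (@filterS _ (nbhs x) _ _ _ _ nx) => y yC s sd; apply: yC.
by rewrite /= in_itv/= -ler_distl.
Qed.

(** Each slice is negligible by [porous_negligible]. Rational gap centers leave only countable
    unions and intersections of open and closed sets, whence the measurability that slicing
    requires. *)
Lemma porous_slices_vnegligible C (c : R) i : 0 < c -> closed C ->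
  vnegligible [set x | C x /\ forall l : nat, exists q : rat,
    [/\ q != 0, `|ratr q : R| < l.+1%:R^-1 &
        forall s : R, `|s - ratr q| <= c * `|ratr q| ->
                  ~ C (x + s *: delta_mx 0 i)]].
Proof.
move=> c0 cC; apply: (vnegligible_slice (i := i)).
  rewrite (_ : mkset _ = C `&` \bigcap_l \bigcup_q
    (if (q != 0) && (`|ratr q : R| < l.+1%:R^-1) then [set x |
        forall s : R, `|s - ratr q| <= c * `|ratr q| ->
                  ~ C (x + s *: delta_mx 0 i)] else set0)).
    rewrite /vmeasurable preimage_setI; apply: measurableI;
      first exact: closed_vmeasurable.
    rewrite preimage_bigcap; apply: bigcap_measurable => // l _.
    rewrite preimage_bigcup; apply: bigcupT_measurable_rat => q.
    case: ifPn => _; last by rewrite preimage_set0.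
    by apply: open_vmeasurable; exact: open_avoid.
  apply/seteqP; split => x [Cx h]; split => // l.
    by have [q [q0 ql qC]] := h l; exists q => //; rewrite q0 ql.
  have [q _ + ] := h l I; case: ifPn => // /andP[q0 ql] qC.
  by exists q; split.
move=> x; pose Cx : set R := [set t | C (x + t *: delta_mx 0 i)].
have cCx : closed Cx.
  apply: (continuous_closedP (fun t : R => x + t *: delta_mx 0 i)).1 cC => t.
  by apply: cvgD; [exact: cvg_cst|apply: cvgZr_tmp; exact: cvg_id].
apply: negligibleS (porous_negligible c0 cCx) => t /= [Ct h]; split => // l.
have [q [q0 ql qC]] := h l; exists (ratr q); split => //.
  by rewrite fmorph_eq0.
by move=> s sq; rewrite /Cx/= scalerDl addrA; exact: qC.
Qed.

End porous_rV.

Lemma lipschitz_continuous (R : realType) (V W : normedModType R) (g : V -> W) (K : R) :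
  0 <= K -> (forall x y, `|g x - g y| <= K * `|x - y|) -> continuous g.
Proof.
move=> K0 gK x; apply/(@cvgrPdist_le _ _ _ (nbhs x)) => e e0; near=> y.
rewrite (le_trans (gK _ _))// (@le_trans _ _ ((K + 1) * `|x - y|))//.
  by rewrite ler_wpM2r// lerDl.
rewrite mulrC -ler_pdivlMr ?ltr_wpDl//.
near: y; apply: cvgr_dist_le; first exact: cvg_id.
by rewrite divr_gt0// ltr_wpDl.
Unshelve. all: by end_near. Qed.

(** * Differentiability almost everywhere, by induction on the coordinates *)

Section rademacher.
Variables (R : realType) (n : nat) (g : 'rV[R]_n -> R) (K : R).
Hypotheses (K0 : 0 <= K) (gK : forall x y, `|g x - g y| <= K * `|x - y|).
Implicit Types (x h s : 'rV[R]_n) (V : set 'rV[R]_n) (i : 'I_n).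
Local Notation inv j := (j.+1%:R^-1 : R).

Let inv_gt0 j : 0 < inv j. Proof. by rewrite invr_gt0. Qed.

(* Points where [g] has slope [s] along [V] at scales at most [1 / (m + 1)], up
   to a relative error [1 / (j + 1)]; unlike the set of points of
   differentiability, it is closed. *)
Definition approx V (m : nat) s (j : nat) : set 'rV[R]_n := [set x |
  forall h, V h -> `|h| <= inv m ->
    `|g (x + h) - g x - dot s h| <= inv j * `|h|].

Lemma closed_approx V m s j : closed (approx V m s j).
Proof.
rewrite (_ : approx _ _ _ _ = \bigcap_(h in [set h | V h /\ `|h| <= inv m])
    ((fun x => `|g (x + h) - g x - dot s h|) @^-1`
      [set y | y <= inv j * `|h|])).
  apply: closed_bigI => h _.
  have cf : continuous (fun x => `|g (x + h) - g x - dot s h|).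
    apply: (@lipschitz_continuous _ _ _ _ (K + K)); first exact: addr_ge0.
    move=> x y; rewrite (le_trans (ler_dist_dist _ _))//.
    rewrite (_ : _ - _ = (g (x + h) - g (y + h)) - (g x - g y)); last by ring.
    rewrite (le_trans (ler_normB _ _))// mulrDl lerD//.
    by rewrite (le_trans (gK _ _))// opprD addrACA subrr addr0.
  by have /continuous_closedP := cf; apply; exact: closed_le.
by apply/seteqP; split => x hx h; [move=> [? ?]; exact: hx|move=> ? ?; exact: hx].
Qed.

(** The span of the first [k] axes, which is the whole space for [k = n]. *)
Definition flat (k : nat) : set 'rV[R]_n :=
  [set h | forall i, (k <= i)%N -> h 0 i = 0].

Definition axis i : set 'rV[R]_n := [set t *: delta_mx 0 i | t in [set: R]].

(** The slopes are rational and may depend on the precision [j], so that for each [j] only countably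
    many closed sets are involved. *)
Definition approx_all V : set 'rV[R]_n := [set x | forall j, exists m,
  exists s : 'rV[rat]_n, approx V m (map_mx ratr s) j x].

Lemma norm_delta_mx i (t : R) : `|t *: (delta_mx 0 i : 'rV[R]_n)| = `|t|.
Proof.
rewrite normrZ (_ : `|delta_mx 0 i| = 1) ?mulr1//.
apply/eqP; rewrite eq_le; apply/andP; split.
  apply: mx_norm_le => // a b; rewrite mxE; case: andP => _; rewrite ?normr1 ?normr0//.
have := coord_le_norm (delta_mx 0 i : 'rV[R]_n) 0 i.
by rewrite mxE !eqxx normr1.
Qed.

(** On each line parallel to the axis, [g] is Lipschitz, hence derivable almost everywhere. Half of
    the error [1 / (j + 1)] is spent on the expansion, half on a rational approximation of the
    derivative. *)
Lemma approx_all_axis i : vnegligible (~` approx_all (axis i)).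
Proof.
pose N j : set 'rV[R]_n :=
  ~` \bigcup_(p : nat * 'rV[rat]_n) approx (axis i) p.1 (map_mx ratr p.2) j.
have -> : ~` approx_all (axis i) = \bigcup_j N j.
  apply/seteqP; split => x.
    move=> /existsNP[j xj]; exists j => // -[[m s] _ /= h]; apply: xj.
    by exists m, s.
  by move=> [j _ xj] /(_ j)[m [s h]]; apply: xj; exists (m, s).
rewrite /vnegligible preimage_bigcup; apply: negligible_bigcup => j.
apply: (vnegligible_slice (i := i)).
  rewrite /N /vmeasurable -preimage_setC; apply: measurableC.
  rewrite preimage_bigcup; apply: countable_bigcupT_measurable => // p.
  by apply: closed_vmeasurable; exact: closed_approx.
move=> x; pose gx t := g (x + t *: delta_mx 0 i).
have gxK (s t : R) : `|gx s - gx t| <= K * `|s - t|.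
  rewrite (le_trans (gK _ _))// opprD addrACA subrr add0r -scalerBl.
  by rewrite norm_delta_mx.
apply: negligibleS (lipschitz_ae_derivable gxK) => t /= + dgx; apply.
pose a := 'D_1 gx t.
have := diff_locally ((derivable1_diffP _ _).1 dgx).
move=> /eqaddoP /(_ (inv j / 2)) /(_ (divr_gt0 (inv_gt0 j) (ltr0n _ 2))).
move=> /nbhs_ballP[d /= d0 dP].
have [m md] : exists m, inv m < d.
  have [k _ kd] := near_infty_natSinv_lt (PosNum d0).
  by exists k; exact: (kd k (leqnn k)).
have [q _] : exists2 q : rat, True & `|ratr q - a| < inv j / 2.
  have [|z [/= az [q _ qz]]] := @dense_rat R (ball a (inv j / 2)) _ (ball_open _ _).
    by exists a; apply: ballxx; rewrite divr_gt0.
  by exists q => //; rewrite qz distrC.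
move=> qa; exists (m, q *: delta_mx 0 i) => //= h [u _ <-{h}].
rewrite norm_delta_mx => um.
have /dP : ball 0 d u by rewrite /ball/= sub0r normrN (le_lt_trans um).
rewrite !fctE/= diff1E//; last exact/derivable1_diffP.
rewrite (_ : map_mx ratr (q *: delta_mx 0 i) = ratr q *: delta_mx 0 i); last first.
  by apply/rowP => b; rewrite !mxE rmorphM/= rmorph_nat.
rewrite dotZl dotZr dot_delta mxE !eqxx mulr1.
rewrite derive1E -/a -[_ *: _]/(u * a) => ua.
rewrite -(addrA x) -scalerDl (addrC t).
rewrite (_ : _ - _ = (gx (u + t) - (gx t + u * a)) - (ratr q - a) * u); last first.
  by rewrite /gx; ring.
rewrite (le_trans (ler_normB _ _))// (splitr (inv j)) [leRHS]mulrDl lerD//.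
by rewrite normrM ler_wpM2r// ltW.
Qed.

(* With [e] the [i]-th axis and [x + t' e] a point of [C] close to [x + t e],
   an increment [h + t e] is followed from [x] to [x + t' e] along the axis and
   then along [h]. *)
Lemma approx_step_bound (k : nat) i (m m' l j : nat) s r x : i = k :> nat ->
  let C := approx (flat k) m s j `&` approx (axis i) m' r j in
  C x ->
  (forall q : rat, q != 0 -> `|ratr q : R| < inv l ->
     exists2 t : R, `|t - ratr q| <= inv j * `|ratr q| & C (x + t *: delta_mx 0 i)) ->
  exists M, forall H, flat k.+1 H -> `|H| <= inv M ->
    `|g (x + H) - g x - dot (\row_b if b == i then r 0 i else s 0 b) H| <=
    inv j * ((6 * K + 8) * `|H|).
Proof.
move=> ik C Cx np.
set e : 'rV[R]_n := delta_mx 0 i.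
have j0 := inv_gt0 j.
have j1 : inv j <= 1 by rewrite invf_le1// ler1n.
(* Moving from [t] to a rational [q] costs [|t| / (j + 1)], and from [q] to a point of [C] at most
   [|q| / (j + 1)] with [|q| <= 2 |t|], whence the factor 3. *)
have close (t : R) : `|t| < inv l / 2 ->
    exists2 t', `|t' - t| <= inv j * (3 * `|t|) & C (x + t' *: e).
  move=> tl; have [->|t0] := eqVneq t 0.
    by exists 0; rewrite ?subrr ?normr0 ?mulr0// scale0r addr0.
  have tt0 : 0 < `|t| by rewrite normr_gt0.
  have [|z [/= tz [q _ qz]]] := @dense_rat R (ball t (inv j * `|t|)) _ (ball_open _ _).
    by exists t; apply: ballxx; rewrite mulr_gt0.
  move: tz; rewrite /ball/= -{z}qz => tq.
  have jt : inv j * `|t| <= `|t| by rewrite ler_piMl.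
  have q0 : q != 0.
    by apply: contraTneq tq => ->; rewrite rmorph0 subr0 -leNgt.
  have q2 : `|ratr q : R| <= 2 * `|t|.
    have := lerB_dist (ratr q : R) t; rewrite (distrC _ t) => /le_trans.
    by move=> /(_ _ (le_trans (ltW tq) jt)); rewrite lerBlDr mulr_natl mulr2n.
  have ql : `|ratr q : R| < inv l by rewrite (le_lt_trans q2)// mulrC -ltr_pdivlMr.
  have [t' t'q Ct'] := np q q0 ql.
  exists t' => //.
  rewrite (_ : t' - t = (t' - ratr q) - (t - ratr q)); last by ring.
  rewrite (le_trans (ler_normB _ _))//.
  rewrite (le_trans (lerD t'q (ltW tq)))//.
  by rewrite -mulrDr ler_pM2l// (_ : 3 * _ = 2 * `|t| + `|t|) ?lerD2r//; ring.
(* At scale [1 / (m' + 1)], the slope [r 0 i] is a difference quotient of [g] up to an error at most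
   1. *)
have ri : `|r 0 i| <= K + 1.
  have m'0 := inv_gt0 m'.
  have := Cx.2 (inv m' *: e); rewrite norm_delta_mx (gtr0_norm m'0).
  move=> /(_ _ (lexx _)) => h.
  have {h} : `|g (x + inv m' *: e) - g x - dot r (inv m' *: e)| <= inv j * inv m'.
    by apply: h; exists (inv m').
  rewrite dotZr dot_delta => h.
  have g1 := gK (x + inv m' *: e) x.
  rewrite (addrC x) addrK norm_delta_mx (gtr0_norm m'0) in g1.
  rewrite -(ler_pM2l m'0) -[X in X * _](gtr0_norm m'0) -normrM.
  rewrite (_ : _ * r 0 i = (g (inv m' *: e + x) - g x) -
    (g (inv m' *: e + x) - g x - inv m' * r 0 i)); last by ring.
  rewrite (le_trans (ler_normB _ _))// mulrDr lerD//.
    by rewrite [leRHS]mulrC; exact: g1.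
  by rewrite (addrC x) in h; rewrite (le_trans h)// mulr1 ler_piMl// ltW.
(* Brings [1 / (M + 1)] within the scales of both expansions and of [close]; the factor 4 absorbs
   [|t'| <= 4 |t|]. *)
exists (m + 4 * m'.+1 + 2 * l.+1)%N => H Hk.
set M := (_ + _)%N => HM.
have Mm : inv M <= inv m by rewrite lef_pV2 ?posrE// ler_nat ltnS /M -addnA leq_addr.
have Mm' : inv M <= inv m' / 4.
  rewrite -invfM lef_pV2 ?posrE ?mulr_gt0// -natrM ler_nat.
  by rewrite mulnC /M ltnW// ltnS -addnA addnCA leq_addr.
have Ml : inv M < inv l / 2.
  rewrite -invfM ltf_pV2 ?posrE ?mulr_gt0// -natrM ltr_nat.
  by rewrite mulnC ltnS leq_addl.
pose t := H 0 i; pose h := H - t *: e.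
have hb b : h 0 b = if b == i then 0 else H 0 b.
  rewrite !mxE eqxx /=; case: eqVneq => [->|_]; first by rewrite mulr1 subrr.
  by rewrite mulr0 subr0.
have hk : flat k h.
  move=> b kb; rewrite hb; case: eqVneq => // bi; apply: Hk.
  by rewrite ltn_neqAle kb andbT -ik eq_sym.
have hH : `|h| <= `|H|.
  apply: mx_norm_le => // a b; rewrite (ord1 a) hb.
  by case: eqP => _; rewrite ?normr0// coord_le_norm.
have tH : `|t| <= `|H| by exact: coord_le_norm.
have [|t' tt' [Cs Cr]] := close t.
  by rewrite (le_lt_trans tH)// (le_lt_trans HM).
have t'4 : `|t'| <= 4 * `|t|.
  rewrite -(subrK t t') (le_trans (ler_normD _ _))//.
  rewrite (_ : 4 * _ = 3 * `|t| + `|t|); last by ring.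
  by rewrite lerD2r (le_trans tt')// ler_piMl// mulr_ge0.
set S := \row_b _.
have -> : dot S H = dot s h + r 0 i * t.
  rewrite {1}(_ : H = h + t *: e); last by rewrite subrK.
  rewrite dotDr dotZr dot_delta mxE eqxx (mulrC t); congr (_ + _).
  apply: eq_bigr => b _; rewrite hb mxE; case: ifP => _ //.
  by rewrite !mulr0.
pose y := x + t' *: e.
(* Four errors: moving from [t] to [t'], the expansion along [h] at [y], the expansion along the
   axis at [x], and the change in the linear term. Their constants [3 K], [1], [4] and [3 (K + 1)]
   add up to [6 K + 8]. *)
rewrite (_ : _ - _ = (g (x + H) - g (y + h)) + (g (y + h) - g y - dot s h)
   + (g y - g x - r 0 i * t') + r 0 i * (t' - t)); last by ring.
have b1 : `|g (x + H) - g (y + h)| <= K * (inv j * (3 * `|H|)).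
  rewrite (le_trans (gK _ _))// ler_wpM2l//.
  rewrite (_ : x + H - (y + h) = (t - t') *: e); last first.
    by apply/rowP => b; rewrite !mxE; ring.
  rewrite norm_delta_mx distrC (le_trans tt')// ler_pM2l//.
  by rewrite ler_pM2l.
have b2 : `|g (y + h) - g y - dot s h| <= inv j * `|H|.
  rewrite (le_trans (Cs h hk (le_trans hH (le_trans HM Mm))))//.
  by rewrite ler_pM2l.
have b3 : `|g y - g x - r 0 i * t'| <= inv j * (4 * `|H|).
  have := Cx.2 (t' *: e); rewrite norm_delta_mx dotZr dot_delta (mulrC t') => h3.
  rewrite (le_trans (h3 _ _))//; first by exists t'.
    by rewrite (le_trans t'4)// mulrC -ler_pdivlMr// (le_trans tH)// (le_trans HM).
  by rewrite ler_pM2l// (le_trans t'4)// ler_pM2l.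
have b4 : `|r 0 i * (t' - t)| <= (K + 1) * (inv j * (3 * `|H|)).
  rewrite normrM ler_pM// (le_trans tt')// ler_pM2l//.
  by rewrite ler_pM2l.
rewrite (le_trans (ler_normD _ _))// (le_trans (lerD (ler_normD _ _) (lexx _)))//.
rewrite (le_trans (lerD (lerD (ler_normD _ _) (lexx _)) (lexx _)))//.
rewrite (le_trans (lerD (lerD (lerD b1 b2) b3) b4))//.
rewrite le_eqVlt; apply/orP; left; apply/eqP; ring.
Qed.

Lemma vnegligibleS (A B : set 'rV[R]_n) : A `<=` B -> vnegligible B -> vnegligible A.
Proof. by move=> AB; apply: negligibleS => t; exact: AB. Qed.

Lemma vnegligible_bigcup (I : countType) (F : I -> set 'rV[R]_n) :
  (forall a : I, vnegligible (F a)) -> vnegligible (\bigcup_a F a).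
Proof.
move=> F0.
pose G k := if unpickle k is Some i then F i else set0.
apply: (@vnegligibleS _ (\bigcup_k G k)).
  by move=> x [i _ Fx]; exists (pickle i) => //; rewrite /G pickleK.
rewrite /vnegligible preimage_bigcup; apply: negligible_bigcup => k.
rewrite /G; case: (unpickle k) => [i|]; first exact: F0.
by rewrite preimage_set0; exact: negligible_set0.
Qed.

(** An exceptional point is exceptional along [flat k] or along the axis, or it is a porous point of
    one of the countably many closed sets [C p]; elsewhere [approx_step_bound] applies. *)
Lemma approx_all_step (k : nat) i : i = k :> nat ->
  vnegligible (~` approx_all (flat k)) -> vnegligible (~` approx_all (flat k.+1)).
Proof.
move=> ik Nk.
pose C (p : nat * 'rV[rat]_n * (nat * 'rV[rat]_n) * nat) :=
  approx (flat k) p.1.1.1 (map_mx ratr p.1.1.2) p.2 `&`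
  approx (axis i) p.1.2.1 (map_mx ratr p.1.2.2) p.2.
pose Z p : set 'rV[R]_n := [set x | C p x /\ forall l : nat, exists q : rat,
    [/\ q != 0, `|ratr q : R| < inv l &
        forall s : R, `|s - ratr q| <= inv p.2 * `|ratr q| ->
                  ~ C p (x + s *: delta_mx 0 i)]].
have Z0 : vnegligible (\bigcup_p Z p).
  apply: vnegligible_bigcup => p; apply: porous_slices_vnegligible => //.
  by apply: closedI; exact: closed_approx.
apply: (@vnegligibleS _ (~` approx_all (flat k) `|` ~` approx_all (axis i)
    `|` \bigcup_p Z p)).
  apply: subsetCl; rewrite !setCU !setCK => x [[xk xi] xZ] j0.
  have K8 : 0 < 6 * K + 8 by rewrite ltr_wpDl// mulr_ge0.
  (* Chaining multiplies the relative error by [6 K + 8], so that the pieces need a precision [j]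
     finer than the target [j0]. *)
  have [j jK] : exists j, inv j < inv j0 / (6 * K + 8).
    have [N _ NP] := near_infty_natSinv_lt (PosNum (divr_gt0 (inv_gt0 j0) K8)).
    by exists N; exact: (NP N (leqnn N)).
  have [m [s xs]] := xk j; have [m' [r xr]] := xi j.
  have Cx : C ((m, s), (m', r), j) x by split.
  have : ~ Z ((m, s), (m', r), j) x by move=> Zx; apply: xZ; exists ((m, s), (m',
    r), j).
  move=> /not_andP[//|/existsNP[l lZ]].
  have [|M xM] := @approx_step_bound k i m m' l j (map_mx ratr s) (map_mx ratr r) x
    ik Cx.
    move=> q q0 ql; apply: contrapT => nq; apply: lZ; exists q; split => // t tq Ct.
    by apply: nq; exists t.
  exists M, (\row_b if b == i then r 0 i else s 0 b) => h hk hM.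
  rewrite (_ : map_mx _ _ = \row_b if b == i then map_mx ratr r 0 i else map_mx
    ratr s 0 b); last first.
    by apply/rowP => b; rewrite !mxE; case: ifP => _; rewrite ?mxE.
  rewrite (le_trans (xM h hk hM))// mulrA ler_wpM2r//.
  by rewrite -ler_pdivlMr// ltW.
rewrite /vnegligible !preimage_setU; apply: negligibleU => //.
by apply: negligibleU => //; exact: approx_all_axis.
Qed.

Lemma approx_all_ae k : (k <= n)%N -> vnegligible (~` approx_all (flat k)).
Proof.
elim: k => [_|k IH kn]; last first.
  exact: (approx_all_step (i := Ordinal kn)) (IH (ltnW kn)).
rewrite (_ : ~` _ = set0); first by rewrite /vnegligible preimage_set0;
  exact: negligible_set0.
rewrite -subset0 => x; apply => j; exists 0%N, 0 => h h0 _.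
rewrite (_ : h = 0); last by apply/rowP => b; rewrite mxE h0.
by rewrite dot0r addr0 subrr subr0 normr0 mulr_ge0.
Qed.

(** Tested at a common scale, the slopes of precisions [j] and [k] differ by at most
    [1 / (j + 1) + 1 / (k + 1)] in each coordinate. The supremum of the lower bounds
    [S j 0 i - 1 / (j + 1)] is then within [1 / (j + 1)] of every [S j 0 i]. *)
Lemma approx_all_frechet x : approx_all setT x -> exists D, frechet g x D.
Proof.
move=> xa.
have /choice[m /choice[s ms]] : forall j, exists m, exists s : 'rV[rat]_n,
    approx setT m (map_mx ratr s) j x by [].
pose S j : 'rV[R]_n := map_mx ratr (s j).
have SS j k i : S j 0 i - inv j <= S k 0 i + inv k.
  pose u := inv (m j + m k).
  have u0 : 0 < u by exact: inv_gt0.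
  have um j' : (m j' <= m j + m k)%N -> u <= inv (m j').
    by move=> h; rewrite lef_pV2 ?posrE// ler_nat ltnS.
  have H j' : (m j' <= m j + m k)%N ->
      `|g (x + u *: delta_mx 0 i) - g x - u * S j' 0 i| <= inv j' * u.
    move=> h; have := ms j' (u *: delta_mx 0 i) I.
    by rewrite norm_delta_mx (gtr0_norm u0) dotZr dot_delta; apply; exact: um.
  have := H j (leq_addr _ _); have := H k (leq_addl _ _).
  rewrite !ler_norml => /andP[_ Hk] /andP[Hj _].
  rewrite -(ler_pM2l u0) mulrBr mulrDr (mulrC u (inv j)) (mulrC u (inv k)).
  have aux (G a b c d : R) : G - b <= d -> - c <= G - a -> a - c <= b + d by lra.
  exact: aux Hk Hj.
pose D : 'rV[R]_n := \row_i sup [set S j 0 i - inv j | j in [set: nat]].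
have DS j i : `|D 0 i - S j 0 i| <= inv j.
  rewrite mxE; set E := [set _ | _ in _].
  have ubE k : ubound E (S k 0 i + inv k) by move=> _ [l _ <-].
  have E0 : E !=set0 by exists (S 0%N 0 i - inv 0); exists 0%N.
  have supE : has_sup E by split => //; exists (S 0%N 0 i + inv 0).
  rewrite ler_distl; apply/andP; split; last exact: ge_sup.
  by apply: ub_le_sup; [case: supE|exists j].
exists D => e e0.
have n1 : 0 < n%:R + 1 :> R by rewrite ltr_wpDl.
have [j je] : exists j, inv j < e / (n%:R + 1).
  have [N _ NP] := near_infty_natSinv_lt (PosNum (divr_gt0 e0 n1)).
  by exists N; exact: (NP N (leqnn N)).
have : \forall h \near (0 : 'rV[R]_n), `|h| <= inv (m j) by exact: nbhs0_le.
apply: filterS => h hm.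
rewrite (_ : _ - _ = (g (x + h) - g x - dot (S j) h) - dot (D - S j) h); last first.
  by rewrite dotBl; ring.
rewrite (le_trans (ler_normB _ _))// (le_trans (lerD (ms j h I hm) (dot_le_norm _
  _)))//.
have DSn : `|D - S j| <= inv j.
  apply: mx_norm_le => [|a b]; first exact: ltW.
  by rewrite (ord1 a) mxE [X in _ + X]mxE; exact: DS.
rewrite (@le_trans _ _ (inv j * `|h| + n%:R * (inv j * `|h|)))//.
  by rewrite lerD2l ler_wpM2l// ler_wpM2r.
rewrite -{1}[inv j * `|h|]mul1r -mulrDl mulrA ler_wpM2r// addrC mulrC.
by rewrite -ler_pdivlMr// ltW.
Qed.

Theorem rademacher :
  vnegligible [set x | ~ exists D, frechet g x D].
Proof.
apply: vnegligibleS (approx_all_ae (leqnn n)) => x /= nD xa; apply: nD.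
apply: approx_all_frechet => j; have [m [s xs]] := xa j.
exists m, s => h _; apply: xs => i /=.
by rewrite leqNgt ltn_ord.
Qed.

End rademacher.

(** * The Euclidean norm *)

Section euclidean_norm.
Variables (R : realType) (n : nat).
Implicit Types (u v w : 'rV[R]_n).

Lemma dot_ge0 u : 0 <= dot u u.
Proof. by apply: sumr_ge0 => i _; rewrite -expr2 sqr_ge0. Qed.

Lemma enorm_ge0 u : 0 <= enorm u. Proof. exact: sqrtr_ge0. Qed.

Lemma enorm_sqr u : enorm u ^+ 2 = dot u u.
Proof. by rewrite sqr_sqrtr// dot_ge0. Qed.

Lemma coord_le_enorm u i : `|u 0 i| <= enorm u.
Proof.
rewrite -sqrtr_sqr ler_wsqrtr// expr2 /dot (bigD1 i)//= lerDl.
by apply: sumr_ge0 => j _; rewrite -expr2 sqr_ge0.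
Qed.

Lemma norm_le_enorm u : `|u| <= enorm u.
Proof.
by apply: mx_norm_le => [|a i]; rewrite ?enorm_ge0// (ord1 a) coord_le_enorm.
Qed.

Lemma enorm_le_norm u : enorm u <= n%:R * `|u|.
Proof.
rewrite -[leRHS]ger0_norm ?mulr_ge0// -sqrtr_sqr ler_wsqrtr//.
rewrite (le_trans (ler_norm _))// (le_trans (dot_le_norm _ _))//.
rewrite exprMn -expr2 ler_wpM2r ?sqr_ge0// -natrX ler_nat.
by rewrite -mulnn; case: (n) => // k; rewrite leq_pmulr.
Qed.

Lemma enorm0 : enorm (0 : 'rV[R]_n) = 0.
Proof. by rewrite /enorm dot0r sqrtr0. Qed.

Lemma enorm_eq0 u : enorm u = 0 -> u = 0.
Proof.
move=> u0; apply/rowP => i; rewrite mxE; apply/eqP; rewrite -normr_eq0.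
by rewrite eq_le normr_ge0 andbT -u0 coord_le_enorm.
Qed.

Lemma enormZ (a : R) u : enorm (a *: u) = `|a| * enorm u.
Proof.
by rewrite /enorm dotZl dotZr mulrA -expr2 sqrtrM ?sqr_ge0// sqrtr_sqr.
Qed.

(** Cauchy-Schwarz, by expanding the squared norm of [enorm v *: u - enorm u *: v]. *)
Lemma dot_le_enorm u v : dot u v <= enorm u * enorm v.
Proof.
have [u0|u0] := eqVneq (enorm u) 0; first by rewrite (enorm_eq0 u0) dot0l enorm0 mul0r.
have [v0|v0] := eqVneq (enorm v) 0; first by rewrite (enorm_eq0 v0) dot0r enorm0 mulr0.
have uv0 : 0 < enorm u * enorm v by rewrite mulr_gt0// lt0r ?u0 ?v0 enorm_ge0.
have := dot_ge0 (enorm v *: u - enorm u *: v).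
rewrite dotBl !dotBr !dotZl !dotZr -!enorm_sqr (dotC v u) => h.
rewrite -subr_ge0 -(pmulr_rge0 _ uv0) -(pmulr_rge0 _ (ltr0n R 2)).
by move: h; congr (_ <= _); ring.
Qed.

Lemma enormD u v : enorm (u + v) <= enorm u + enorm v.
Proof.
rewrite -(@ler_pXn2r _ 2) ?nnegrE ?addr_ge0 ?enorm_ge0//.
rewrite enorm_sqr dotDl !dotDr (dotC v u) sqrrD -!enorm_sqr.
by have := dot_le_enorm u v; lra.
Qed.

Lemma ler_enorm_dist u v : `|enorm u - enorm v| <= enorm (u - v).
Proof.
have h u' v' : enorm u' - enorm v' <= enorm (u' - v').
  by rewrite lerBlDr -{1}(subrK v' u') enormD.
rewrite ler_norml h andbT lerNl opprB (le_trans (h _ _))//.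
by rewrite -opprB -scaleN1r enormZ normrN1 mul1r.
Qed.

Lemma continuous_enorm : continuous (@enorm R n).
Proof.
apply: (@lipschitz_continuous _ _ _ _ n%:R) => // u v.
by rewrite (le_trans (ler_enorm_dist _ _))// enorm_le_norm.
Qed.

End euclidean_norm.

(** * Expectations of bounded random variables *)

Section ae_bounded.
Variables (R : realType) (d : measure_display) (T : measurableType d).
Variable P : probability T R.
Local Notation E := (fun X : T -> R => \int[P]_u X u)%R.
Implicit Types X Y : T -> R.

Lemma ae_forall_fin (I : finType) (A : I -> T -> Prop) :
  (forall i, {ae P, forall u, A i u}) -> {ae P, forall u i, A i u}.
Proof.
move=> Aae; have : P.-negligible (\big[setU/set0]_i [set u | ~ A i u]).
  by elim/big_ind : _ => [|B C|i _]; [exact: negligible_set0|exact: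
    negligibleU|exact: Aae].
apply: negligibleS => u /= /existsNP[i nA].
by rewrite -bigcup_seq; exists i; rewrite //= mem_index_enum.
Qed.

Lemma ae_exists (A : T -> Prop) : {ae P, forall u, A u} -> exists u, A u.
Proof.
move=> [N [mN N0 AN]]; apply: contrapT => nA.
have : P setT = 0%E by apply: subset_measure0 N0 => // u _; apply: AN => Au;
  apply: nA; exists u.
by rewrite [LHS]probability_setT => /eqP; rewrite onee_eq0.
Qed.

(** The bound is asked almost everywhere since a continuous function is bounded on the ball, which
    has full measure, but possibly not on all of R^n. *)
Definition ae_bounded X := measurable_fun setT X /\
  exists M : R, {ae P, forall u, `|X u| <= M}.

Lemma ae_bounded_integrable X : ae_bounded X -> P.-integrable setT (EFin \o X).
Proof.
move=> [mX [M XM]]; apply/integrableP; split; first exact/measurable_EFinP.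
have mabs : measurable_fun setT (fun u => `|(EFin \o X) u|)%E.
  by apply: measurableT_comp => //; exact/measurable_EFinP.
apply: (@le_lt_trans _ _ (\int[P]_u (cst `|M|%:E) u)%E).
  apply: ae_ge0_le_integral => //; first by move=> u _; rewrite /= lee_fin.
  by move: XM; apply: filterS => u XM _; rewrite /= lee_fin (le_trans XM)// ler_norm.
by rewrite integral_cst// [X in (_ * X)%E](@probability_setT _ _ _ P) mule1 ltry.
Qed.

Lemma ae_bounded_cst c : ae_bounded (cst c).
Proof. by split => //; exists `|c|; apply: aeW. Qed.

Lemma ae_boundedD X Y : ae_bounded X -> ae_bounded Y -> ae_bounded (fun u => X u + Y u).
Proof.
move=> [mX [M XM]] [mY [N YN]]; split; first exact: measurable_funD.
exists (M + N); move: XM YN; apply: filterS2 => u XM YN.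
by rewrite (le_trans (ler_normD _ _))// lerD.
Qed.

Lemma ae_boundedM X Y : ae_bounded X -> ae_bounded Y -> ae_bounded (fun u => X u * Y u).
Proof.
move=> [mX [M XM]] [mY [N YN]]; split; first exact: measurable_funM.
exists (M * N); move: XM YN; apply: filterS2 => u XM YN.
by rewrite normrM ler_pM.
Qed.

Lemma ae_boundedZ c X : ae_bounded X -> ae_bounded (fun u => c * X u).
Proof. exact: ae_boundedM (ae_bounded_cst c). Qed.

Lemma ae_boundedB X Y : ae_bounded X -> ae_bounded Y -> ae_bounded (fun u => X u - Y u).
Proof.
move=> bX bY; apply: ae_boundedD => //.
by rewrite (_ : (fun _ => _) = (fun u => -1 * Y u));
  [exact: ae_boundedZ|apply/funext => u; rewrite mulN1r].
Qed.

Lemma ae_bounded_norm X : ae_bounded X -> ae_bounded (fun u => `|X u|).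
Proof.
move=> [mX [M XM]]; split; first exact: measurableT_comp.
by exists M; move: XM; apply: filterS => u; rewrite normr_id.
Qed.

Lemma ae_bounded_sum (I : Type) (s : seq I) (F : I -> T -> R) :
  (forall i, ae_bounded (F i)) -> ae_bounded (fun u => \sum_(i <- s) F i u).
Proof.
move=> bF; elim: s => [|i s IH].
  by rewrite (_ : (fun _ => _) = cst 0); [exact: ae_bounded_cst|apply/funext => u;
    rewrite big_nil].
rewrite (_ : (fun _ => _) = (fun u => F i u + \sum_(i <- s) F i u)).
  exact: ae_boundedD.
by apply/funext => u; rewrite big_cons.
Qed.

Lemma expect_cst c : E (cst c) = c.
Proof.
rewrite [LHS](@Rintegral_cst _ _ _ P _ measurableT c).
by rewrite [X in fine X](@probability_setT _ _ _ P) mulr1.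
Qed.

Lemma expectB X Y : ae_bounded X -> ae_bounded Y -> E (fun u => X u - Y u) = E X - E Y.
Proof. by move=> bX bY; apply: RintegralB => //; exact: ae_bounded_integrable. Qed.

Lemma expectZ c X : ae_bounded X -> E (fun u => c * X u) = c * E X.
Proof. by move=> bX; apply: RintegralZl => //; exact: ae_bounded_integrable. Qed.

Lemma expect_sum (I : Type) (s : seq I) (F : I -> T -> R) :
  (forall i, ae_bounded (F i)) -> E (fun u =>
    \sum_(i <- s) F i u) = \sum_(i <- s) E (F i).
Proof.
move=> bF; elim: s => [|i s IH].
  rewrite big_nil -[RHS]expect_cst; congr (E _).
  by apply/funext => u; rewrite big_nil.
rewrite big_cons -IH -RintegralD//; try exact: ae_bounded_integrable.
  by congr (E _); apply/funext => u; rewrite big_cons.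
by apply: ae_bounded_integrable; exact: ae_bounded_sum.
Qed.

Lemma expect_le X Y : ae_bounded X -> ae_bounded Y -> {ae P, forall u, X u <= Y u} ->
  E X <= E Y.
Proof.
move=> bX bY XY; rewrite -subr_ge0 -expectB//.
have bYX := ae_boundedB bY bX.
(* Nonnegative everywhere, and almost everywhere equal to [Y - X]. *)
pose Z u := Num.max 0 (Y u - X u).
have mZ : measurable_fun setT Z by apply: measurable_maxr => //; exact: bYX.1.
rewrite /Rintegral (@ae_eq_integral _ _ _ _ setT (EFin \o Z))//.
- by apply: Rintegral_ge0 => u _; rewrite le_max lexx.
- by apply/measurable_EFinP; exact: bYX.1.
- exact/measurable_EFinP.
- by move: XY; apply: filterS => u XY _; rewrite /Z /= max_r// subr_ge0.
Qed.

Lemma expect_le_cst X M : ae_bounded X -> {ae P, forall u, X u <= M} -> E X <= M.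
Proof.
by move=> bX XM; rewrite -[leRHS]expect_cst; apply: expect_le => //;
  exact: ae_bounded_cst.
Qed.

Lemma expect_norm_le X M : ae_bounded X -> {ae P, forall u, `|X u| <= M} -> `|E X| <= M.
Proof.
move=> bX XM; rewrite (le_trans (le_normr_Rintegral _ (ae_bounded_integrable bX)))//.
by apply: expect_le_cst => //; exact: ae_bounded_norm.
Qed.

Lemma expect_cvg0 (X : nat -> T -> R) (M : R) :
  (forall k, measurable_fun setT (X k)) ->
  {ae P, forall u k, `|X k u| <= M} ->
  {ae P, forall u, X k u @[k --> \oo] --> (0 : R)} ->
  E (X k) @[k --> \oo] --> (0 : R).
Proof.
move=> mX XM X0.
have M0 : ae_bounded (cst M) by exact: ae_bounded_cst.
have [] := @dominated_convergence _ _ _ P setT measurableT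
  (fun k u => (X k u)%:E) (cst 0%E) (cst M%:E).
- by move=> k; apply/measurable_EFinP.
- exact: measurable_cst.
- by move: X0; apply: filterS => u X0 _; apply/cvg_EFin => //; exact: nearW.
- exact: ae_bounded_integrable M0.
- by move: XM; apply: filterS => u XM k _; rewrite lee_fin.
move=> _ _; rewrite integral0 => /fine_cvg.
exact.
Qed.

End ae_bounded.

(** * The uniform distribution on the unit ball *)

Section unif_ball_theory.
Variables (R : realType).
Local Notation mu := (@lebesgue_measure R).
Local Notation T n := (n.-tuple (measurableTypeR R)).

Definition box n (I : set R) : set (T n) := [set t | forall i, I (tnth t i)].

Lemma measurable_box n (I : set R) : measurable I -> measurable (@box n I).
Proof.
move=> mI; rewrite (_ : box I = \bigcap_(i in [set: 'I_n]) ((@tnth n _)^~ i @^-1` I)).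
  apply: fin_bigcap_measurable => // i _.
  by rewrite -[X in measurable X]setTI; exact: measurable_tnth.
by apply/seteqP; split => t h i; [move=> _; exact: h|exact: h].
Qed.

Lemma box_measure n (I : set R) : measurable I ->
  (0 < mu I)%E -> (mu I < +oo)%E ->
  (0 < lebesgue_tuple R n (@box n I))%E /\ (lebesgue_tuple R n (@box n I) < +oo)%E.
Proof.
move=> mI I0 Ioo; elim: n => [|n [IH0 IHoo]].
  rewrite /= /dirac indicE mem_set; last by case.
  by rewrite lte01 ltry.
have E : @tcons R n @^-1` @box n.+1 I = I `*` @box n I.
  apply/seteqP; split => [[a t] h|[a t] [Ia It] i].
    split; first by have := h ord0; rewrite tnth0.
    by move=> i; have := h (lift ord0 i); rewrite tnthS.
  by case: (unliftP ord0 i) => [j|] ->; rewrite ?tnthS ?tnth0//; exact: It.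
rewrite /= /measure_cons /pushforward E product_measure1E//; last exact: measurable_box.
by rewrite mule_gt0// lte_mul_pinfty// ge0_fin_numE.
Qed.

Variable n : nat.
Local Notation P := (unif_ball R n).
Local Notation V := (lebesgue_tuple R n (@tuple_ball R n)).

Lemma tuple_ballE t : @tuple_ball R n t <-> enorm (rV_of_tuple t) <= 1.
Proof. by rewrite /tuple_ball /eball /= subr0. Qed.

(** The ball lies between the cubes of half-widths [1 / (n + 1)] and 1, the former because
    [enorm u <= n * |u|]; [n + 1] also covers [n = 0]. *)
Lemma tuple_ball_measure : (0 < V)%E /\ (V < +oo)%E.
Proof.
split.
  have n0 : 0 < n.+1%:R^-1 :> R by rewrite invr_gt0.
  have [||+ _] := @box_measure n `[(- n.+1%:R^-1),
    n.+1%:R^-1]%classic (measurable_itv _).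
  - by rewrite lebesgue_measure_itv/= lte_fin gtrN// -EFinB lte_fin subr_gt0 gtrN.
  - by rewrite lebesgue_measure_itv/=; case: ifPn => _; rewrite -?EFinB ltry.
  move=> /lt_le_trans; apply; apply: le_measure; rewrite ?inE.
  - by apply: measurable_box; exact: measurable_itv.
  - exact: measurable_tuple_ball.
  - move=> t tI; apply/tuple_ballE; rewrite (le_trans (enorm_le_norm _))//.
    rewrite (@le_trans _ _ (n%:R * n.+1%:R^-1))//.
      rewrite ler_wpM2l//; apply: mx_norm_le => [|a i]; first exact: ltW.
      by rewrite mxE; have := tI i; rewrite /= in_itv/= ler_norml.
    by rewrite ler_pdivrMr// mul1r ler_nat.
have [||_] := @box_measure n `[(-1), 1]%classic (measurable_itv _).
- by rewrite lebesgue_measure_itv/= lte_fin gtrN// -EFinB lte_fin subr_gt0 gtrN.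
- by rewrite lebesgue_measure_itv/=; case: ifPn => _; rewrite -?EFinB ltry.
apply: le_lt_trans; apply: le_measure; rewrite ?inE.
- exact: measurable_tuple_ball.
- by apply: measurable_box; exact: measurable_itv.
- move=> t /tuple_ballE t1 i; rewrite /= in_itv/= -ler_norml.
  by have := coord_le_enorm (rV_of_tuple t) i; rewrite mxE => /le_trans; apply.
Qed.

(** The volume is neither zero nor infinite, which discards the default branch of [mnormalize]. *)
Lemma unif_ballE (A : set (T n)) : P A = (lebesgue_tuple R n (A `&` @tuple_ball R
  n) * ((fine V)^-1)%:E)%E.
Proof.
have [V0 Voo] := tuple_ball_measure.
have VT : mrestr (lebesgue_tuple R n) (@measurable_tuple_ball R n) [set: T n] = V.
  by rewrite /mrestr setTI.
rewrite [LHS]/(mnormalize _ _ A) /mnormalize.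
rewrite [X in fine X]VT [X in X == 0]VT [X in X == +oo%E]VT ifF//.
by apply/negbTE; rewrite negb_or gt_eqF// lt_eqF.
Qed.

(** The uniform distribution is absolutely continuous with respect to Lebesgue measure; this carries
    Rademacher's theorem over to random points. *)
Lemma unif_ball_ae (A : set 'rV[R]_n) : vnegligible (~` A) ->
  {ae P, forall u, A (rV_of_tuple u)}.
Proof.
move=> [N [mN N0 AN]]; exists N; split => //.
rewrite [LHS]unif_ballE (_ : lebesgue_tuple _ _ _ = 0%E) ?mul0e//.
apply: subset_measure0 N0 => //; apply: measurableI => //.
exact: measurable_tuple_ball.
Qed.

Lemma unif_ball_ae_ball : {ae P, forall u, enorm (rV_of_tuple u) <= 1}.
Proof.
exists (~` @tuple_ball R n); split.
- by apply: measurableC; exact: measurable_tuple_ball.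
- by rewrite [LHS]unif_ballE setICl measure0 mul0e.
- by move=> u /= h /tuple_ballE.
Qed.

Lemma ball_smoothingE (sigma : R) (f : 'rV[R]_n -> R) x :
  ball_smoothing sigma f x = (\int[P]_u f (x + sigma *: rV_of_tuple u))%R.
Proof. by rewrite /ball_smoothing unlock. Qed.

Lemma ae_bounded_continuous (phi : 'rV[R]_n -> R) : continuous phi ->
  ae_bounded P (fun u => phi (rV_of_tuple u)).
Proof.
move=> cphi; split; first exact: measurable_continuous_rV.
have cB : compact [set v : 'rV[R]_n | enorm v <= 1].
  apply: bounded_closed_compact.
    exists 1; split => // M M1 v v1; rewrite /=.
    by rewrite (le_trans (norm_le_enorm v))// (le_trans v1)// ltW.
  rewrite (_ : mkset _ = @enorm R n @^-1` [set r | r <= 1])//.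
  by have /continuous_closedP := @continuous_enorm R n; apply; exact: closed_le.
have /compact_bounded[M [_ MP]] := continuous_compact (continuous_subspaceT cphi) cB.
exists (`|M| + 1); move: unif_ball_ae_ball; apply: filterS => u u1.
apply: (MP (`|M| + 1)); last by exists (rV_of_tuple u).
by rewrite (le_lt_trans (ler_norm M))// ltrDl.
Qed.

End unif_ball_theory.

(** * Hessians and quadratic forms *)

Section jacobian_quad.
Variables (R : realType) (n : nat).
Implicit Types (G : 'rV[R]_n -> 'rV[R]_n) (x w h : 'rV[R]_n).

Lemma frechet_components G x (D : 'I_n -> 'rV[R]_n) :
  (forall i, frechet (fun y => G y 0 i) x (D i)) ->
  differentiable G x /\ forall h, 'd G x h = \row_i dot (D i) h.
Proof.
move=> GD.
have dG : differentiable G x.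
  rewrite (_ : G = \sum_i (fun y => G y 0 i *: (delta_mx 0 i : 'rV[R]_n))).
    apply: differentiable_sum => i; apply: differentiableZl.
    exact: frechet_differentiable (GD i).
  by apply/funext => y; rewrite {1}(row_sum_delta (G y)) fct_sumE.
split => // h; rewrite -deriveE// derive_mx; last exact: diff_derivable.
apply/rowP => i; rewrite !mxE deriveE; last exact: frechet_differentiable (GD i).
by rewrite (frechet_diff (GD i)).
Qed.

Lemma differentiable_components G x : differentiable G x ->
  forall i, differentiable (fun y => G y 0 i) x.
Proof.
move=> dG i.
by apply: (@differentiable_comp _ _ _ _ G (fun M : 'rV[R]_n => M 0 i)) => //;
  exact: differentiable_coord.
Qed.

(** The Jacobian multiplies row vectors on the right, whereas [quad] uses the transpose; a quadratic
    form takes the same values for both. *)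
Lemma quad_jacobian G x w : quad (jacobian G x) w = dot ('d G x w) w.
Proof.
rewrite -[in RHS]mul_rV_lin1 -/(jacobian G x) /quad; set J := jacobian G x.
rewrite /dot (eq_bigr (fun i => \sum_j w 0 j * J i j * w 0 i)); last first.
  by move=> i _; rewrite mxE mulr_suml; apply: eq_bigr => j _; rewrite mxE.
rewrite exchange_big; apply: eq_bigr => j _ /=.
by rewrite mxE mulr_suml; apply: eq_bigr => i _; ring.
Qed.

End jacobian_quad.

(** * Mean values along lines and Lipschitz gradients *)

Lemma is_derive_line (R : realType) (n : nat) (f : 'rV[R]_n -> R) (x h : 'rV[R]_n)
  (t : R) :
  differentiable f (x + t *: h) ->
  is_derive t (1 : R) (fun s => f (x + s *: h)) (dot (grad f (x + t *: h)) h).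
Proof.
move=> df; pose phi (s : R) := f (x + s *: h).
have E : (fun s : R => s^-1 *: ((phi \o shift t) (s *: (1 : R)) - phi t)) =
    (fun s : R => s^-1 *: ((f \o shift (x + t *: h)) (s *: h) - f (x + t *: h))).
  apply/funext => s; rewrite /phi /= [s *: 1]mulr1 scalerDl.
  by rewrite addrCA.
apply: DeriveDef.
  by rewrite /derivable E; exact: diff_derivable.
by rewrite /derive E -grad_dot// -deriveE.
Qed.

Lemma mean_value_line (R : realType) (n : nat) (f : 'rV[R]_n -> R) (x h : 'rV[R]_n)
  (s : R) :
  0 < s -> (forall y, differentiable f y) ->
  exists2 c, 0 < c < s & f (x + s *: h) - f x = s * dot (grad f (x + c *: h)) h.
Proof.
move=> s0 df; pose phi (t : R) := f (x + t *: h).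
have dphi t : is_derive t (1 : R) phi (dot (grad f (x + t *: h)) h).
  exact: is_derive_line.
have cphi : {within `[0, s], continuous phi}.
  apply: continuous_subspaceT => t; apply: differentiable_continuous.
  by apply/derivable1_diffP; have [] := dphi t.
have [c] := MVT s0 (fun t _ => dphi t) cphi.
rewrite in_itv/= /phi scale0r addr0 subr0 mulrC => c0s ->.
by exists c.
Qed.

Section lipschitz_gradient.
Variables (R : realType) (n : nat) (f : 'rV[R]_n -> R) (L : R).
Hypotheses (L0 : 0 <= L) (fL : smooth L f).
Implicit Types (x y h : 'rV[R]_n).

Lemma grad_coord_lipschitz i x y :
  `|grad f x 0 i - grad f y 0 i| <= L * n%:R * `|x - y|.
Proof.
have := coord_le_enorm (grad f x - grad f y) i.
rewrite !mxE => /le_trans; apply; rewrite (le_trans (fL.2 x y))// -mulrA.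
by rewrite ler_wpM2l// enorm_le_norm.
Qed.

(** By the mean value theorem, the remainder comes from the variation of the gradient over a
    distance at most [|h|]. The bound is uniform in [x], so that it can be averaged; the factors [n]
    are due to the sup norm. *)
Lemma smooth_remainder x h :
  `|f (x + h) - f x - dot (grad f x) h| <= n%:R * (L * n%:R) * `|h| ^+ 2.
Proof.
have [c /andP[c0 c1]] := mean_value_line x h ltr01 fL.1.
rewrite scale1r mul1r => ->.
rewrite -dotBl (le_trans (dot_le_norm _ _))// expr2 !mulrA ler_wpM2r// -!mulrA.
rewrite ler_wpM2l//; apply: mx_norm_le => [|a i]; first by rewrite !mulr_ge0.
rewrite (ord1 a) mxE [X in _ + X]mxE (le_trans (grad_coord_lipschitz _ _ _))// -mulrA.
rewrite ler_wpM2l// ler_wpM2l// addrC addKr normrZ ler_piMl//.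
by rewrite ger0_norm ltW.
Qed.

End lipschitz_gradient.

(** * Smoothing over the ball *)

Section smoothing_calculus.
Variables (R : realType) (n : nat) (sigma : R).
Hypothesis sigma_gt0 : 0 < sigma.
Local Notation P := (unif_ball R n).
Local Notation T := (n.-tuple (measurableTypeR R)).
Local Notation E := (fun X : T -> R => \int[P]_u X u)%R.
Local Notation S u := (sigma *: rV_of_tuple u).
Implicit Types (x y h : 'rV[R]_n) (g f : 'rV[R]_n -> R).

Lemma ae_bounded_shift g x : continuous g -> ae_bounded P (fun u => g (x + S u)).
Proof.
move=> cg; apply: (@ae_bounded_continuous _ _ (fun v => g (x + sigma *: v))) => v.
have xv : x + sigma *: w @[w --> v] --> x + sigma *: v.
  by apply: (@cvgD _ _ _ (nbhs v) _ (cst x) ( *:%R sigma));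
    [exact: cvg_cst|exact: scaler_continuous].
by apply: (cvg_comp (fun w => x + sigma *: w) g xv); exact: cg.
Qed.

Lemma dot_expect (X : 'I_n -> T -> R) h : (forall i, ae_bounded P (X i)) ->
  dot (\row_i E (X i)) h = E (fun u => dot (\row_i X i u) h).
Proof.
move=> bX; rewrite [in RHS]/dot expect_sum; last first.
  move=> i; rewrite (_ : (fun _ => _) = (fun u => h 0 i * X i u)).
    exact: ae_boundedZ.
  by apply/funext => u; rewrite mxE mulrC.
apply: eq_bigr => i _; rewrite mxE mulrC -expectZ//.
by congr (E _); apply/funext => u; rewrite mxE mulrC.
Qed.

Lemma ae_bounded_dot (X : 'I_n -> T -> R) h : (forall i, ae_bounded P (X i)) ->
  ae_bounded P (fun u => dot (\row_i X i u) h).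
Proof.
move=> bX; apply: ae_bounded_sum => i.
rewrite (_ : (fun _ => _) = (fun u => h 0 i * X i u)); first exact: ae_boundedZ.
by apply/funext => u; rewrite mxE mulrC.
Qed.

(** The expansions given by [smooth_remainder] at all points of the ball are averaged, their error
    being uniform. *)
Lemma frechet_smoothing f (L : R) x : 0 <= L -> smooth L f ->
  frechet (ball_smoothing sigma f) x (\row_i E (fun u => grad f (x + S u) 0 i)).
Proof.
move=> L0 fL e e0.
pose C := n%:R * (L * n%:R).
have C0 : 0 <= C by rewrite !mulr_ge0.
have C1 : 0 < C + 1 by rewrite ltr_wpDl.
have cf : continuous f by move=> y; apply: differentiable_continuous; exact: fL.1.
have bg i : ae_bounded P (fun u => grad f (x + S u) 0 i).
  apply: (@ae_bounded_shift (fun y => grad f y 0 i)).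
  apply: (lipschitz_continuous (mulr_ge0 L0 (ler0n R n))) => y z.
  exact: grad_coord_lipschitz.
have bf y : ae_bounded P (fun u => f (y + S u)) by exact: ae_bounded_shift.
have : \forall h \near (0 : 'rV[R]_n), `|h| <= e / (C + 1).
  by apply: nbhs0_le; rewrite divr_gt0.
apply: filterS => h hC.
rewrite dot_expect// !ball_smoothingE -expectB// -expectB//; last 2 first.
  exact: ae_boundedB.
  exact: ae_bounded_dot.
apply: expect_norm_le.
  by apply: ae_boundedB; [exact: ae_boundedB|exact: ae_bounded_dot].
apply: aeW => u.
rewrite (_ : \row_i _ = grad f (x + S u)); last by apply/rowP => i; rewrite !mxE.
rewrite (addrAC x h) (le_trans (smooth_remainder L0 fL _ _))// -/C expr2 mulrA.
rewrite ler_wpM2r// (@le_trans _ _ ((C + 1) * `|h|))//.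
  by rewrite ler_wpM2r// lerDl.
by rewrite mulrC -ler_pdivlMr.
Qed.

(** * Averages of Lipschitz functions *)

Section lipschitz.
Variables (g : 'rV[R]_n -> R) (K : R).
Hypotheses (K0 : 0 <= K) (gK : forall x y, `|g x - g y| <= K * `|x - y|).

(** Rademacher's theorem for [g (x + sigma *: v)] as a function of [v]; dividing its gradient by
    [sigma] returns to [g]. *)
Lemma rademacher_shift x :
  {ae P, forall u, exists D, frechet g (x + S u) D}.
Proof.
pose g' v := g (x + sigma *: v).
have g'K v w : `|g' v - g' w| <= K * sigma * `|v - w|.
  rewrite (le_trans (gK _ _))// opprD addrACA subrr add0r -scalerBr normrZ.
  by rewrite gtr0_norm// mulrA.
have Ks0 : 0 <= K * sigma by rewrite mulr_ge0// ltW.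
have := @unif_ball_ae _ _ [set v | exists D, frechet g' v D] (rademacher Ks0 g'K).
apply: filterS => u [D gD].
exists (sigma^-1 *: D) => e e0.
have es0 : 0 < e * sigma by rewrite mulr_gt0.
have [r/= r0 rP] := (nbhs_ballP _ _).1 (gD _ es0).
apply/nbhs_ballP; exists (r * sigma) => /=; first by rewrite mulr_gt0.
move=> h; rewrite -ball_normE/= sub0r normrN => hr.
have sh : sigma *: (sigma^-1 *: h) = h by rewrite scalerA mulfV ?gt_eqF// scale1r.
have := rP (sigma^-1 *: h); rewrite -ball_normE/= sub0r normrN.
rewrite normrZ gtr0_norm ?invr_gt0// mulrC ltr_pdivrMr// => /(_ hr).
rewrite /g' scalerDr sh addrA dotZr -dotZl => /le_trans; apply.
by rewrite -mulrA [sigma * _]mulrCA mulfV ?gt_eqF// mulr1.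
Qed.

(** The gradients of [rademacher_shift] are chosen pointwise, with no measurability in [u]. Each
    coordinate is recovered as a limit of the measurable difference quotients [q j k], bounded by
    [K]. *)
Lemma rademacher_measurable x : exists D : 'I_n -> T -> R,
  (forall j, ae_bounded P (D j)) /\
  {ae P, forall u, frechet g (x + S u) (\row_j D j u)}.
Proof.
have cg := lipschitz_continuous K0 gK.
pose q j (k : nat) u : R :=
  k.+1%:R * (g (x + k.+1%:R^-1 *: delta_mx 0 j + S u) - g (x + S u)).
have qK j k u : `|q j k u| <= K.
  rewrite normrM ger0_norm// -ler_pdivlMl// (le_trans (gK _ _))//.
  rewrite opprD addrACA subrr addr0 addrAC subrr add0r norm_delta_mx.
  by rewrite ger0_norm ?invr_ge0// mulrC.
(* The upper limit is measurable everywhere, and a limit almost everywhere. *)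
pose D j u := limn_sup (fun k => q j k u).
have mD j : measurable_fun setT (D j).
  apply: measurable_fun_limn_sup => [u _|u _|k].
  - by exists K => _ [k _ <-]; rewrite (le_trans (ler_norm _)).
  - by exists (- K) => _ [k _ <-]; have := qK j k u; rewrite ler_norml => /andP[].
  - apply: measurable_funM => //; apply: measurable_funB.
      exact: (ae_bounded_shift _ cg).1.
    exact: (ae_bounded_shift _ cg).1.
have Dae : {ae P, forall u, frechet g (x + S u) (\row_j D j u) /\
                            forall j, `|D j u| <= K}.
  move: (rademacher_shift x); apply: filterS => u [G gG].
  have qG j : q j k u @[k --> \oo] --> G 0 j.
    apply/cvgrPdist_le => e e0.
    have := gG _ e0 => /nbhs_ballP[r/= r0 rP].
    have := near_infty_natSinv_lt (PosNum r0); apply: filterS => k /= kr.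
    have k0 : 0 < k.+1%:R^-1 :> R by rewrite invr_gt0.
    have := rP (k.+1%:R^-1 *: delta_mx 0 j).
    rewrite -ball_normE/= sub0r normrN norm_delta_mx (gtr0_norm k0) => /(_ kr).
    rewrite dotZr dot_delta => h; rewrite distrC /q.
    rewrite -(ler_pM2l k0) (mulrC _ e) (le_trans _ h)//
      -[X in X * _ <= _](gtr0_norm k0).
    by rewrite -normrM mulrBr mulKf// (addrAC x).
  have DG j : D j u = G 0 j.
    rewrite /D cvg_limn_supE; last by apply/cvg_ex; exists (G 0 j); exact: qG.
    by apply/cvg_lim; [exact: Rhausdorff|exact: qG].
  split; first by rewrite (_ : \row_j _ = G)//; apply/rowP => j; rewrite mxE DG.
  move=> j; rewrite DG; apply: (cvgr_to_le (cvg_norm (qG j))).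
  by apply: nearW => k; exact: qK.
exists D; split; last by move: Dae; apply: filterS => u [].
by move=> j; split => //; exists K; move: Dae; apply: filterS => u [_].
Qed.

(** Were the expansion false, it would fail along increments [h k] tending to 0. The remainders
    divided by [|h k|] are bounded and tend to 0 almost everywhere, so that [expect_cvg0] gives a
    contradiction. *)
Lemma frechet_expect x (D : 'I_n -> T -> R) : (forall j, ae_bounded P (D j)) ->
  {ae P, forall u, frechet g (x + S u) (\row_j D j u)} ->
  frechet (fun y => E (fun u => g (y + S u))) x (\row_j E (D j)).
Proof.
move=> bD Dae e e0; apply: contrapT => /nbhs_ballP nh.
have cg := lipschitz_continuous K0 gK.
have bg y : ae_bounded P (fun u => g (y + S u)) by exact: ae_bounded_shift.
pose X h u := g (x + h + S u) - g (x + S u) - dot (\row_j D j u) h.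
have bX h : ae_bounded P (X h).
  by apply: ae_boundedB; [exact: ae_boundedB|exact: ae_bounded_dot].
have EX h : E (fun u => g (x + h + S u)) - E (fun u => g (x + S u))
    - dot (\row_j E (D j)) h = E (X h).
  rewrite dot_expect// -expectB// -expectB//; first exact: ae_boundedB.
  exact: ae_bounded_dot.
have /choice[h hP] : forall k : nat, exists h,
    `|h| < k.+1%:R^-1 /\ e * `|h| < `|E (X h)|.
  move=> k; apply: contrapT => nk; apply: nh; exists k.+1%:R^-1 => /=.
    by rewrite invr_gt0.
  move=> h; rewrite -ball_normE/= sub0r normrN => hk.
  by rewrite EX leNgt; apply/negP => he; apply: nk; exists h.
have h0 k : 0 < `|h k|.
  rewrite normr_gt0; apply/eqP => hk0; have := (hP k).2.
  rewrite hk0 -EX normr0 mulr0 addr0 subrr dot0r subr0 normr0 ltxx.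
  by [].
have [N NP] : exists N : R, {ae P, forall u j, `|D j u| <= N}.
  have /choice[N /ae_forall_fin NP] := fun j => (bD j).2.
  exists (\sum_j `|N j|); move: NP; apply: filterS => u NP j.
  rewrite (le_trans (NP j))// (le_trans (ler_norm _))//.
  by rewrite (bigD1 j)//= lerDl sumr_ge0.
pose Y k u := `|h k|^-1 * X (h k) u.
have bY k : ae_bounded P (Y k) by exact: ae_boundedZ.
have : E (Y k) @[k --> \oo] --> (0 : R).
  apply: (@expect_cvg0 _ _ _ P Y (K + n%:R * `|N|)) => [k||].
  - exact: (bY k).1.
  - move: NP; apply: filterS => u NP k.
    rewrite normrM gtr0_norm ?invr_gt0// ler_pdivrMl// mulrDr.
    rewrite (le_trans (ler_normB _ _))// lerD//.
      by rewrite (le_trans (gK _ _))// opprD addrACA subrr addr0 addrAC subrr add0r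
        mulrC.
    rewrite (le_trans (dot_le_norm _ _))// [leRHS]mulrCA ler_wpM2l//
      [leRHS]mulrC ler_wpM2r//.
    by apply: mx_norm_le => // a j; rewrite mxE (le_trans (NP j))// ler_norm.
  - move: Dae; apply: filterS => u gD; apply/cvgrPdist_le => r r0.
    have := gD _ r0 => /nbhs_ballP[s/= s0 sP].
    have := near_infty_natSinv_lt (PosNum s0); apply: filterS => k /= ks.
    rewrite sub0r normrN normrM gtr0_norm ?invr_gt0// ler_pdivrMl// mulrC.
    have := sP (h k); rewrite -ball_normE/= sub0r normrN (addrAC x).
    by move=> /(_ (lt_trans (hP k).1 ks)); rewrite /X (addrAC x).
move=> /cvgrPdist_lt /(_ _ e0)[k _ kP].
have := kP k (leqnn k); apply/negP; rewrite -leNgt sub0r normrN.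
rewrite /= expectZ// normrM gtr0_norm ?invr_gt0// ler_pdivlMl// mulrC.
exact: ltW (hP k).2.
Qed.

End lipschitz.
End smoothing_calculus.

(** * Quadratic forms, smallest eigenvalue, symmetry of the Hessian *)

Section quadratic_forms.
Variables (R : realType) (n : nat).
Implicit Types (A B : 'M[R]_n) (u v w : 'rV[R]_n).

Lemma dot_mulmx u v : dot u v = (u *m v^T) 0 0.
Proof. by rewrite mxE; apply: eq_bigr => i _; rewrite mxE. Qed.

Lemma dot_mul_trmx A u v : dot (u *m A^T) v = dot u (v *m A).
Proof. by rewrite !dot_mulmx trmx_mul mulmxA. Qed.

Lemma norm_mulmx_tr A w : `|w *m A^T| <= n%:R * (`|w| * `|A|).
Proof.
apply: mx_norm_le => [|a i]; first by rewrite !mulr_ge0.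
rewrite mxE (le_trans (ler_norm_sum _ _ _))//.
rewrite (le_trans (ler_sum _ (G := fun=> `|w| * `|A|) _))//.
  by move=> j _; rewrite normrM ler_pM ?coord_le_norm// mxE coord_le_norm.
by rewrite sumr_const card_ord mulr_natl.
Qed.

Lemma quadBl A B w : quad A w - quad B w = quad (A - B) w.
Proof. by rewrite /quad -dotBl -mulmxBr [(A - B)^T]raddfB. Qed.

Lemma quadDl A B (a b : R) w : quad (a *: A + b *: B) w = a * quad A w + b * quad B w.
Proof.
rewrite /quad -!dotZl -dotDl; congr dot.
by rewrite linearD !linearZ /= mulmxDr -!scalemxAr.
Qed.

Lemma quad_le_norm A w : `|quad A w| <= n%:R * (n%:R * (`|w| * `|A|) * `|w|).
Proof.
rewrite (le_trans (dot_le_norm _ _))// ler_wpM2l// ler_wpM2r//.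
exact: norm_mulmx_tr.
Qed.

Lemma continuous_quad_l w : continuous (fun A : 'M[R]_n => quad A w).
Proof.
apply: (@lipschitz_continuous _ _ _ _ (n%:R * n%:R * (`|w| * `|w|))) => [|A B].
  by rewrite !mulr_ge0.
rewrite quadBl (le_trans (quad_le_norm _ _))//.
by rewrite le_eqVlt; apply/orP; left; apply/eqP; ring.
Qed.

Lemma quad_dist A u v :
  `|quad A u - quad A v| <= n%:R * n%:R * `|A| * ((`|u| + `|v|) * `|u - v|).
Proof.
rewrite (_ : _ - _ = dot (u *m A^T) (u - v) + dot ((u - v) *m A^T) v); last first.
  by rewrite dotBr mulmxBl dotBl addrA subrK.
rewrite (le_trans (ler_normD _ _))//.
rewrite (le_trans (lerD (dot_le_norm _ _) (dot_le_norm _ _)))//.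
rewrite (le_trans (lerD (ler_wpM2l (ler0n _ _) (ler_wpM2r (normr_ge0 _)
  (norm_mulmx_tr A u)))
  (ler_wpM2l (ler0n _ _) (ler_wpM2r (normr_ge0 _) (norm_mulmx_tr A (u - v))))))//.
by rewrite le_eqVlt; apply/orP; left; apply/eqP; ring.
Qed.

(** A local Lipschitz bound, shared by a quadratic form and by the maximum of such forms over the
    Goldstein Hessian. *)
Lemma continuous_quad_bound (F : 'rV[R]_n -> R) (C : R) : 0 <= C ->
  (forall u v, `|F u - F v| <= C * ((`|u| + `|v|) * `|u - v|)) -> continuous F.
Proof.
move=> C0 FC u; apply/(@cvgrPdist_le _ _ _ (nbhs u)) => e e0; near=> v.
have uv1 : `|u - v| <= 1 by near: v; apply: cvgr_dist_le => //; exact: cvg_id.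
pose c := C * (`|u| + (`|u| + 1)).
have c0 : 0 <= c by rewrite mulr_ge0// !addr_ge0.
rewrite (le_trans (FC _ _))// mulrA (@le_trans _ _ ((c + 1) * `|u - v|))//.
  rewrite ler_wpM2r// (@le_trans _ _ c) ?lerDl// ler_wpM2l// lerD2l.
  by have := lerB_dist v u; rewrite (distrC v) lerBlDr addrC => /le_trans; apply;
    rewrite lerD2l.
rewrite mulrC -ler_pdivlMr ?ltr_wpDl//.
near: v; apply: cvgr_dist_le; first exact: cvg_id.
by rewrite divr_gt0// ltr_wpDl// mulr_ge0// !addr_ge0.
Unshelve. all: by end_near. Qed.

Lemma continuous_quad A : continuous (quad A).
Proof.
by apply: (continuous_quad_bound (mulr_ge0 (mulr_ge0 (ler0n R n) (ler0n R n))
  (normr_ge0 A))) => u v; exact: quad_dist.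
Qed.

Lemma quadZr A (a : R) w : quad A (a *: w) = a ^+ 2 * quad A w.
Proof. by rewrite /quad -scalemxAl dotZl dotZr mulrA expr2. Qed.

Lemma compact_esphere : compact (esphere R n).
Proof.
apply: bounded_closed_compact.
  exists 1; split => // M M1 v v1; rewrite /=.
  by rewrite (le_trans (norm_le_enorm v))// v1 ltW.
rewrite (_ : esphere R n = @enorm R n @^-1` [set r | r = 1])//.
by have /continuous_closedP := @continuous_enorm R n; apply; exact: closed_eq.
Qed.

Lemma esphere_nonempty : (0 < n)%N -> esphere R n !=set0.
Proof.
move=> n0; exists (delta_mx 0 (Ordinal n0)).
by rewrite /esphere/= /enorm dot_delta mxE !eqxx sqrtr1.
Qed.

(* The minimum [m] of the quadratic form on the sphere is an eigenvalue: if it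
   is attained at [v], then [quad A - m |.|^2] is nonnegative and vanishes at
   [v], so that its gradient [2 (A v - m v)] vanishes too. *)
Lemma lambda_min_le_quad A w : (0 < n)%N -> A^T = A -> enorm w = 1 ->
  lambda_min A <= quad A w.
Proof.
move=> n0 symA w1.
have [v] := EVT_min_rV (esphere_nonempty n0) compact_esphere
  (continuous_subspaceT (@continuous_quad A)).
rewrite inE => v1 vmin; pose m := quad A v.
have quad_ge u : m * dot u u <= quad A u.
  have [->|u0] := eqVneq u 0; first by rewrite /quad mul0mx !dot0l mulr0.
  have nu0 : enorm u != 0 by apply: contra_neq u0 => /enorm_eq0.
  have := vmin ((enorm u)^-1 *: u); rewrite inE /esphere/= enormZ.
  rewrite normrV ?unitfE// ger0_norm ?enorm_ge0// mulVf// => /(_ erefl).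
  rewrite quadZr exprVn -/m => h.
  by rewrite -enorm_sqr mulrC -ler_pdivlMl// exprn_gt0// lt0r nu0 enorm_ge0.
pose z := v *m A^T - m *: v.
have vv : dot v v = 1 by rewrite -enorm_sqr v1 expr1n.
have symdot u : dot (u *m A^T) v = dot (v *m A^T) u.
  by rewrite dot_mul_trmx symA dotC.
(* Expansion of [quad A - m |.|^2] at [v + t *: y], where the constant term vanishes. *)
have key y t : 0 <= t ^+ 2 * (quad A y - m * dot y y)
    + 2 * t * (dot (v *m A^T) y - m * dot v y).
  have := quad_ge (v + t *: y); rewrite -subr_ge0; congr (0 <= _).
  rewrite /quad mulmxDl -scalemxAl !dotDl !dotDr !dotZl !dotZr symdot.
  by rewrite -/(quad A y) -/(quad A v) -/m vv (dotC y v); ring.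
have keyz t : 0 <= t ^+ 2 * (quad A z - m * dot z z) + 2 * t * dot z z.
  have vz : dot (v *m A^T) z - m * dot v z = dot z z by rewrite -dotZl -dotBl.
  by have := key z t; rewrite vz.
have z0 : dot z z = 0.
  apply/eqP; rewrite eq_le dot_ge0 andbT leNgt; apply/negP => zz0.
  pose q := `|quad A z - m * dot z z| + 1.
  have q0 : 0 < q by rewrite ltr_wpDl.
  (* At this [t] the quadratic term is at most [(dot z z)^2 / q], half the size of the negative
     linear term. *)
  have := keyz (- (dot z z / q)); rewrite leNgt => /negP; apply.
  rewrite sqrrN (@le_lt_trans _ _ ((dot z z / q) ^+ 2 * q - 2 * (dot z z / q) * dot
    z z))//.
    rewrite mulrN mulNr lerD2r ler_wpM2l ?sqr_ge0//.
    by rewrite (le_trans (ler_norm _))// lerDl.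
  rewrite expr2 -mulrA divfK ?gt_eqF// -mulrBl.
  by rewrite nmulr_rlt0// subr_lt0 ltr_pMl ?divr_gt0// ltr1n.
have zE : z = 0 by apply: enorm_eq0; rewrite /enorm z0 sqrtr0.
apply: (@le_trans _ _ m); last by apply: vmin; rewrite inE.
(* An infimum is a lower bound only of a set bounded below: [m] bounds the eigenvalues, by [quad_ge]
   on eigenvectors. *)
apply: ge_inf.
  exists m => a /eigenvalueP[u uA u0].
  have uu0 : 0 < dot u u.
    rewrite -enorm_sqr exprn_gt0// lt0r enorm_ge0 andbT.
    by apply: contra_neq u0 => /enorm_eq0.
  have := quad_ge u; rewrite /quad symA uA dotZl.
  by rewrite ler_pM2r.
apply/eigenvalueP; exists v.
  by apply/eqP; rewrite -subr_eq0 -{1}symA -/z zE.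
by apply: contra_eq_neq v1 => ->; rewrite enorm0 eq_sym oner_eq0.
Qed.

Lemma coordB u v i : (u - v) 0 i = u 0 i - v 0 i.
Proof. by rewrite !mxE. Qed.

Lemma frechet_shift (f : 'rV[R]_n -> R) (x c D : 'rV[R]_n) :
  frechet f (x + c) D -> frechet (fun y => f (y + c)) x D.
Proof. by move=> fD e e0; apply: filterS (fD _ e0) => h; rewrite (addrAC x). Qed.

Lemma frechetB (f g : 'rV[R]_n -> R) (x D D' : 'rV[R]_n) :
  frechet f x D -> frechet g x D' -> frechet (fun y => f y - g y) x (D - D').
Proof.
move=> fD gD e e0; have e2 : 0 < e / 2 by rewrite divr_gt0.
apply: filterS2 (fD _ e2) (gD _ e2) => h fh gh.
rewrite dotBl (_ : _ - _ = (f (x + h) - f x - dot D h) - (g (x + h) - g x - dot D'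
  h)); last by ring.
rewrite (le_trans (ler_normB _ _))// (le_trans (lerD fh gh))//.
by rewrite -mulrDl -splitr.
Qed.

Lemma hess_coord (phi : 'rV[R]_n -> R) (x : 'rV[R]_n) i j :
  differentiable (grad phi) x ->
  hess phi x i j = grad (fun y => grad phi y 0 j) x 0 i.
Proof.
move=> dg.
have fr k : frechet (fun y => grad phi y 0 k) x (grad (fun y => grad phi y 0 k) x).
  by apply: differentiable_frechet; exact: differentiable_components.
by rewrite /hess /jacobian mxE (frechet_components fr).2 mxE dot_delta.
Qed.

(** Differentiability of the gradient at [x] suffices: the second difference [Del s i j] is
    symmetric in [i] and [j], and its quotient by [s ^+ 2] tends to either mixed derivative as [s]
    decreases to 0. *)
Lemma hess_sym (phi : 'rV[R]_n -> R) (x : 'rV[R]_n) :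
  (forall y, differentiable phi y) -> differentiable (grad phi) x ->
  (hess phi x)^T = hess phi x.
Proof.
move=> dphi dg.
have fr i : frechet (fun y => grad phi y 0 i) x (grad (fun y => grad phi y 0 i) x).
  by apply: differentiable_frechet; exact: differentiable_components.
pose D i := grad (fun y => grad phi y 0 i) x.
have hessE i j : hess phi x i j = D j 0 i by exact: hess_coord.
pose Del (s : R) i j := phi (x + s *: delta_mx 0 i + s *: delta_mx 0 j)
  - phi (x + s *: delta_mx 0 i) - phi (x + s *: delta_mx 0 j) + phi x.
have DelC s i j : Del s i j = Del s j i.
  by rewrite /Del (addrAC x); ring.
have second i j e : 0 < e ->
    \forall s \near 0^'+, `|Del s i j - s ^+ 2 * D i 0 j| <= 3 * e * s ^+ 2.
  move=> e0; have [r/= r0 rP] := (nbhs_ballP _ _).1 (fr i _ e0).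
  near=> s.
  have s0 : 0 < s by near: s; exact: nbhs_right_gt.
  have sr : 2 * s < r.
    by rewrite mulrC -ltr_pdivlMr//; near: s; apply: nbhs_right_lt; rewrite divr_gt0.
  (* [Del s i j] is the increment of [psi] along the [i]-th axis. The mean value theorem turns it
     into a difference of [i]-th partial derivatives at [x + h1] and [x + h2], both expanded at [x];
     the errors [e * (2 * s)] and [e * s] give the factor 3. *)
  pose psi y := phi (y + s *: delta_mx 0 j) - phi y.
  have psiD y : frechet psi y (grad phi (y + s *: delta_mx 0 j) - grad phi y).
    apply: frechetB; last exact: differentiable_frechet.
    by apply: frechet_shift; exact: differentiable_frechet.
  have dpsi y : differentiable psi y by exact: frechet_differentiable (psiD y).
  have [c /andP[c0 cs]] := mean_value_line x (delta_mx 0 i) s0 dpsi.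
  rewrite (frechet_grad (psiD _)) dot_delta coordB => E.
  pose h1 : 'rV[R]_n := c *: delta_mx 0 i + s *: delta_mx 0 j.
  pose h2 : 'rV[R]_n := c *: delta_mx 0 i.
  have h1s : `|h1| <= 2 * s.
    rewrite (le_trans (ler_normD _ _))// !norm_delta_mx !gtr0_norm// mulr_natl mulr2n.
    by rewrite lerD2r ltW.
  have h2s : `|h2| <= s by rewrite norm_delta_mx gtr0_norm// ltW.
  have a1 : `|grad phi (x + h1) 0 i - grad phi x 0 i - dot (D i) h1| <= e * (2 * s).
    rewrite (le_trans (rP h1 _)) ?ler_pM2l//.
    by rewrite -ball_normE/= sub0r normrN (le_lt_trans h1s).
  have a2 : `|grad phi (x + h2) 0 i - grad phi x 0 i - dot (D i) h2| <= e * s.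
    rewrite (le_trans (rP h2 _)) ?ler_pM2l//.
    by rewrite -ball_normE/= sub0r normrN (le_lt_trans h2s)// (lt_trans _ sr)//
      ltr_pMl// ltr1n.
  rewrite (_ : _ - _ = s * ((grad phi (x + h1) 0 i - grad phi x 0 i - dot (D i) h1) -
     (grad phi (x + h2) 0 i - grad phi x 0 i - dot (D i) h2))); last first.
    have -> : Del s i j = psi (x + s *: delta_mx 0 i) - psi x by rewrite /Del /psi;
      ring.
    rewrite E /h1 /h2 dotDr !dotZr !dot_delta addrA; ring.
  rewrite normrM gtr0_norm// (_ : 3 * e * s ^+ 2 = s * (e * (2 * s) + e * s));
    last by ring.
  by rewrite ler_pM2l// (le_trans (ler_normB _ _))// lerD.
apply/matrixP => i j; rewrite mxE !hessE; apply/eqP.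
rewrite -subr_eq0 -normr_le0; apply/ler_addgt0Pr => e e0; rewrite add0r.
have e6 : 0 < e / 6 by rewrite divr_gt0.
near (0 : R)^'+ => s.
have s0 : 0 < s by near: s; exact: nbhs_right_gt.
have s20 : 0 < s ^+ 2 by rewrite exprn_gt0.
have d1 : `|Del s i j - s ^+ 2 * D i 0 j| <= 3 * (e / 6) * s ^+ 2 by near: s;
  exact: second.
have d2 : `|Del s j i - s ^+ 2 * D j 0 i| <= 3 * (e / 6) * s ^+ 2 by near: s;
  exact: second.
rewrite -(ler_pM2l s20) -{1}(gtr0_norm s20) -normrM.
rewrite (_ : s ^+ 2 * _ = (Del s j i - s ^+ 2 * D j 0 i) - (Del s i j - s ^+ 2 * D
  i 0 j)); last first.
  by rewrite (DelC s j i); ring.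
rewrite (le_trans (ler_normB _ _))// (le_trans (lerD d2 d1))//.
by rewrite le_eqVlt; apply/orP; left; apply/eqP; field.
Unshelve. all: by end_near. Qed.

End quadratic_forms.

(** * The Goldstein Hessian *)

(** Carried over from row vectors by [vec_mx], which preserves the sup norm. *)
Lemma compact_mx_norm_le (R : realType) (m n : nat) (c : R) :
  compact [set A : 'M[R]_(m, n) | `|A| <= c].
Proof.
have [c0|c0] := ltP c 0.
  rewrite (_ : mkset _ = set0); first exact: compact0.
  by rewrite -subset0 => A /=; rewrite leNgt (lt_le_trans c0).
have -> : [set A : 'M[R]_(m, n) | `|A| <= c] =
    vec_mx @` [set v : 'rV[R]_(m * n) | `|v| <= c].
  apply/seteqP; split => [A /= Ac|_ [v /= vc <-]].
    exists (mxvec A); last exact: mxvecK.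
    rewrite /=; apply: mx_norm_le => // a k; rewrite (ord1 a).
    by case: (mxvec_indexP k) => i j; rewrite mxvecE (le_trans (coord_le_norm _ _ _)).
  apply: mx_norm_le => // i j.
  by rewrite mxE (le_trans (coord_le_norm _ _ _)).
apply: continuous_compact.
  apply: continuous_subspaceT; apply: (@lipschitz_continuous _ _ _ _ 1) => // u v.
  rewrite mul1r -linearB; apply: mx_norm_le => // i j.
  by rewrite mxE coord_le_norm.
apply: bounded_closed_compact.
  by exists c; split => [|M cM v /= vc]; [exact: num_real|rewrite (le_trans vc)// ltW].
rewrite (_ : mkset _ = (fun v : 'rV[R]_(m * n) => `|v|) @^-1` [set r | r <= c])//.
have /continuous_closedP := @norm_continuous _ 'rV[R]_(m * n).
by apply; exact: closed_le.
Qed.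

Section goldstein.
Variables (R : realType) (n : nat) (f : 'rV[R]_n -> R) (L : R).
Hypotheses (L0 : 0 <= L) (fL : smooth L f).
Implicit Types (x y z w : 'rV[R]_n) (H : 'M[R]_n).

Definition hessian_graph : set ('rV[R]_n * 'M[R]_n) :=
  [set p | twice_differentiable f p.1 /\ p.2 = hess f p.1].

Lemma smooth_near_differentiable y : \forall z \near y, differentiable f z.
Proof. by near=> z; exact: fL.1. Unshelve. all: by end_near. Qed.

Lemma frechet_bound (g : 'rV[R]_n -> R) (K : R) z D i :
  (forall x y, `|g x - g y| <= K * `|x - y|) -> frechet g z D -> `|D 0 i| <= K.
Proof.
move=> gK gD; apply/ler_addgt0Pr => e e0.
have [r/= r0 rP] := (nbhs_ballP _ _).1 (gD _ e0).
pose t := r / 2; have t0 : 0 < t by rewrite divr_gt0.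
have := rP (t *: delta_mx 0 i); rewrite -ball_normE/= sub0r normrN norm_delta_mx.
rewrite (gtr0_norm t0) dotZr dot_delta => /(_ _) gt.
have {}gt : `|g (z + t *: delta_mx 0 i) - g z - t * D 0 i| <= e * t.
  by apply: gt; rewrite /t ltr_pdivrMr// ltr_pMr// ltr1n.
rewrite -(ler_pM2l t0) -{1}(gtr0_norm t0) -normrM.
rewrite (_ : t * D 0 i = (g (z + t *: delta_mx 0 i) - g z)
  - (g (z + t *: delta_mx 0 i) - g z - t * D 0 i)); last by ring.
rewrite (le_trans (ler_normB _ _))// (le_trans (lerD (gK _ _) gt))//.
by rewrite (addrC z) addrK norm_delta_mx (gtr0_norm t0) -mulrDl mulrC.
Qed.

Lemma hess_norm_le z : differentiable (grad f) z -> `|hess f z| <= L * n%:R.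
Proof.
move=> dg; apply: mx_norm_le => [|i j]; first by rewrite mulr_ge0.
rewrite hess_coord//.
apply: frechet_bound (differentiable_frechet (differentiable_components dg j)).
by move=> x y; exact: grad_coord_lipschitz.
Qed.

(** Trading sequences for the closure of a graph makes the limiting Hessians at varying points a
    closed set of pairs. *)
Lemma limiting_hessiansP y H : limiting_hessians f y H <-> closure hessian_graph (y, H).
Proof.
split=> [[z [zd zy zH]] B yB|yH].
  have [k _ kP] := cvg_pair zy zH yB.
  by exists (z k, hess f (z k)); split; [by split;
    [exact: zd|]|exact: (kP k (leqnn k))].
have /choice[p pP] : forall k : nat, exists p,
    hessian_graph p /\ ball (y, H) k.+1%:R^-1 p.
  move=> k; have [|p [gp yp]] := yH (ball (y, H) k.+1%:R^-1).
    by apply: nbhsx_ballx; rewrite invr_gt0.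
  by exists p.
have near_inv (e : R) : 0 < e -> \forall k \near \oo, k.+1%:R^-1 < e :> R.
  by move=> e0; exact: (near_infty_natSinv_lt (PosNum e0)).
exists (fst \o p); split => [k||].
- exact: (pP k).1.1.
- apply/cvg_ballP => e /near_inv; apply: filterS => k ke.
  by apply: le_ball (pP k).2.1; exact: ltW.
- apply/cvg_ballP => e /near_inv; apply: filterS => k ke.
  by rewrite /= -(pP k).1.2; apply: le_ball (pP k).2.2; exact: ltW.
Qed.

Lemma limiting_hessian_norm_le y H : limiting_hessians f y H -> `|H| <= L * n%:R.
Proof.
move=> [z [zd _ zH]]; apply: (cvgr_to_le (cvg_norm zH)).
by apply: nearW => k; exact: hess_norm_le (zd k).2.
Qed.

Lemma closed_eball x (r : R) : closed (eball x r).
Proof.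
rewrite (_ : eball x r = (fun y => enorm (y - x)) @^-1` [set s | s <= r])//.
have c : continuous (fun y => enorm (y - x)).
  apply: (@lipschitz_continuous _ _ _ _ n%:R) => // u v.
  rewrite (_ : u - v = (u - x) - (v - x)); last by rewrite opprB addrA subrK.
  rewrite (le_trans _ (enorm_le_norm _))//.
  exact: ler_enorm_dist.
by have /continuous_closedP := c; apply; exact: closed_le.
Qed.

(** Keeping the base point next to the matrix gives a compact set, on which quadratic forms attain
    their maximum before any convex hull is taken. *)
Definition hessian_pairs x (r : R) : set ('rV[R]_n * 'M[R]_n) :=
  [set p | eball x r p.1 /\ limiting_hessians f p.1 p.2].

Lemma compact_hessian_pairs x (r : R) : compact (hessian_pairs x r).
Proof.
apply: (@subclosed_compact _ _ (eball x r `*` [set A : 'M[R]_n | `|A| <= L * n%:R])).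
- rewrite (_ : hessian_pairs x r = (fst @^-1` eball x r) `&` closure hessian_graph).
    apply: closedI; last exact: closed_closure.
    have /continuous_closedP : continuous (@fst 'rV[R]_n 'M[R]_n) by move=> p;
      exact: cvg_fst.
    by apply; exact: closed_eball.
  by apply/seteqP; split => -[y H] [xy /limiting_hessiansP yH]; split.
- apply: compact_setX; last exact: compact_mx_norm_le.
  apply: bounded_closed_compact; last exact: closed_eball.
  exists (r + `|x|); split => [|M rM y yr]; first exact: num_real.
  rewrite /= (le_trans _ (ltW rM))// -{1}(subrK x y) (le_trans (ler_normD _ _))//.
  by rewrite lerD2r (le_trans (norm_le_enorm _)).
- by move=> [y H] [/= xy /limiting_hessian_norm_le yH].
Qed.

(** [quad] is linear in the matrix; this lets an upper bound pass to convex hulls. *)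
Lemma convex_quad_le w (c : R) : convex_set [set A : 'M[R]_n | quad A w <= c].
Proof.
move=> A B t; rewrite !inE/= => Ac Bc.
rewrite [X in quad X](_ : _ = t%:num *: (A : 'M[R]_n) + (1 - t%:num) *: (B :
  'M[R]_n))//.
rewrite quadDl (le_trans (lerD (ler_wpM2l _ Ac) (ler_wpM2l _ Bc)))//.
by rewrite -mulrDl addrC subrK mul1r.
Qed.

(** The maximum over the compact set [hessian_pairs] stays one after both convex hulls, by
    [convex_quad_le]. *)
Lemma goldstein_max x (r : R) w : hessian_pairs x r !=set0 ->
  exists M, is_max [set quad A w | A in goldstein_hessian r f x] M /\
    forall y, eball x r y -> differentiable (grad f) y -> quad (hess f y) w <= M.
Proof.
move=> S0.
have cq : continuous (fun p : 'rV[R]_n * 'M[R]_n => quad p.2 w).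
  move=> p; apply: (cvg_comp (@snd 'rV[R]_n 'M[R]_n) (fun A => quad A w));
    first exact: cvg_snd.
  exact: continuous_quad_l.
have [[y H]] := compact_EVT_max S0 (@compact_hessian_pairs x r)
  (continuous_subspaceT cq).
rewrite inE => -[xy yH] Hmax; exists (quad H w); split; last first.
  move=> z xz dz; apply: (Hmax (z, hess f z)); rewrite inE; split => //=.
  exists (fun=> z); split; [|exact: cvg_cst|exact: cvg_cst].
  by move=> _; split => //; exact: smooth_near_differentiable.
split.
  exists H => //; apply: sub_gen_smallest; exists y => //.
  exact: sub_gen_smallest.
move=> _ [A Ag <-]; move: A Ag; apply: smallest_sub; first exact: convex_quad_le.
move=> A [z xz]; move: A; apply: smallest_sub; first exact: convex_quad_le.
by move=> A zA; apply: (Hmax (z, A)); rewrite inE.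
Qed.

(** A matrix attaining the maximum for one vector is tested on the other. The bound [L * n] on
    limiting Hessians passes to the hulls, norm balls being convex. *)
Lemma goldstein_quad_dist x (r : R) u v Mu Mv :
  is_max [set quad A u | A in goldstein_hessian r f x] Mu ->
  is_max [set quad A v | A in goldstein_hessian r f x] Mv ->
  `|Mu - Mv| <= n%:R * n%:R * (L * n%:R) * ((`|u| + `|v|) * `|u - v|).
Proof.
have gL A : goldstein_hessian r f x A -> `|A| <= L * n%:R.
  have cN : convex_set [set A : 'M[R]_n | `|A| <= L * n%:R].
    move=> B D t; rewrite !inE/= => Bc Dc.
    rewrite [X in `|X|](_ : _ = t%:num *: (B : 'M[R]_n) + (1 - t%:num) *: (D :
      'M[R]_n))//.
    rewrite (le_trans (ler_normD _ _))// !normrZ !ger0_norm ?subr_ge0//.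
    rewrite (le_trans (lerD (ler_wpM2l _ Bc) (ler_wpM2l _ Dc)))//.
    by rewrite -mulrDl addrC subrK mul1r.
  move: A; apply: smallest_sub => // A [z _]; move: A; apply: smallest_sub => // A zA.
  exact: limiting_hessian_norm_le zA.
have half u' v' Mu' Mv' :
    is_max [set quad A u' | A in goldstein_hessian r f x] Mu' ->
    is_max [set quad A v' | A in goldstein_hessian r f x] Mv' ->
    Mu' - Mv' <= n%:R * n%:R * (L * n%:R) * ((`|u'| + `|v'|) * `|u' - v'|).
  move=> [[A Ag <-] _] [_ ub]; have /ub Av : [set quad A v' | A in
    goldstein_hessian r f x] (quad A v').
    by exists A.
  rewrite (le_trans (lerB (lexx _) Av))// (le_trans (ler_norm _))//.
  rewrite (le_trans (quad_dist _ _ _))// ler_wpM2r ?mulr_ge0// ?addr_ge0//.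
  by rewrite ler_wpM2l ?mulr_ge0// gL.
move=> maxu maxv; rewrite ler_norml (half _ _ _ _ maxu maxv) andbT lerNl opprB.
by rewrite (le_trans (half _ _ _ _ maxv maxu))// distrC (addrC `|v|).
Qed.

End goldstein.

(** * Gradient and Hessian of the smoothed function *)

Section smoothing_estimates.
Variables (R : realType) (n : nat) (sigma L : R) (f : 'rV[R]_n -> R).
Hypotheses (sigma_gt0 : 0 < sigma) (L0 : 0 <= L) (fL : smooth L f).
Local Notation P := (unif_ball R n).
Local Notation T := (n.-tuple (measurableTypeR R)).
Local Notation E := (fun X : T -> R => \int[P]_u X u)%R.
Local Notation S u := (sigma *: rV_of_tuple u).
Implicit Types (x y w : 'rV[R]_n).

Lemma continuous_grad_coord i : continuous (fun y => grad f y 0 i).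
Proof.
apply: (lipschitz_continuous (mulr_ge0 L0 (ler0n R n))) => y z.
exact: grad_coord_lipschitz.
Qed.

Lemma grad_smoothing x :
  grad (ball_smoothing sigma f) x = \row_i E (fun u => grad f (x + S u) 0 i).
Proof. exact: frechet_grad (@frechet_smoothing _ _ sigma f L x L0 fL). Qed.

Lemma differentiable_smoothing x : differentiable (ball_smoothing sigma f) x.
Proof. exact: frechet_differentiable (@frechet_smoothing _ _ sigma f L x L0 fL). Qed.

(** Testing the difference [v] of the gradients against itself leads to a scalar expectation:
    [dot v v] is an average of numbers at most [L * sigma * enorm v]. *)
Lemma grad_smoothing_dist x :
  enorm (grad f x - grad (ball_smoothing sigma f) x) <= L * sigma.
Proof.
set v := _ - _.
have [v0|v0] := eqVneq (enorm v) 0; first by rewrite v0 mulr_ge0// ltW.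
have v_gt0 : 0 < enorm v by rewrite lt0r v0 enorm_ge0.
rewrite -(ler_pM2r v_gt0) -expr2 enorm_sqr {1}/v dotBl grad_smoothing.
have bg i : ae_bounded P (fun u => grad f (x + S u) 0 i).
  by apply: (@ae_bounded_shift _ _ sigma (fun y => grad f y 0 i) x);
    exact: continuous_grad_coord.
rewrite dot_expect// -[X in X - _](expect_cst P) -expectB//; last 2 first.
  exact: ae_bounded_cst.
  exact: ae_bounded_dot.
apply: expect_le_cst.
  by apply: ae_boundedB; [exact: ae_bounded_cst|exact: ae_bounded_dot].
move: (@unif_ball_ae_ball R n); apply: filterS => u u1.
rewrite (_ : \row_i _ = grad f (x + S u)); last by apply/rowP => i; rewrite !mxE.
rewrite -dotBl (le_trans (dot_le_enorm _ _))// ler_wpM2r ?enorm_ge0//.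
rewrite (le_trans (fL.2 _ _))// ler_wpM2l// opprD addrA subrr sub0r -scaleN1r.
by rewrite !enormZ normrN1 mul1r (gtr0_norm sigma_gt0) ler_piMr// ltW.
Qed.

(** Each coordinate of the gradient is Lipschitz, so that [rademacher_measurable] and
    [frechet_expect] apply to it; [D i j] is a measurable version of the second derivatives of [f]
    at the random point. *)
Lemma smoothing_twice_differentiable x : exists D : 'I_n -> 'I_n -> T -> R,
  [/\ forall i j, ae_bounded P (D i j),
      {ae P, forall u i, frechet (fun y => grad f y 0 i) (x + S u) (\row_j D i j u)} &
      forall i, frechet (fun y => grad (ball_smoothing sigma f) y 0 i) x
                        (\row_j E (D i j))].
Proof.
have gK i y z := grad_coord_lipschitz L0 fL i y z.
have K0 : 0 <= L * n%:R by rewrite mulr_ge0.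
have /choice[D DP] := fun i => rademacher_measurable sigma_gt0 K0 (gK i) x.
exists D; split => [i j||i]; first exact: (DP i).1.
  by apply: ae_forall_fin => i; exact: (DP i).2.
have := frechet_expect K0 (gK i) (DP i).1 (DP i).2.
by congr frechet; apply/funext => y; rewrite grad_smoothing mxE.
Qed.

Lemma ae_differentiable_grad x :
  {ae P, forall u, eball x sigma (x + S u) /\ differentiable (grad f) (x + S u)}.
Proof.
have [D [_ Dae _]] := smoothing_twice_differentiable x.
move: Dae (@unif_ball_ae_ball R n); apply: filterS2 => u Du u1; split.
  rewrite /eball/= addrAC subrr add0r enormZ (gtr0_norm sigma_gt0).
  by rewrite ler_piMr// ltW.
exact: (frechet_components Du).1.
Qed.

Lemma differentiable_grad_smoothing x : differentiable (grad (ball_smoothing sigma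
  f)) x.
Proof.
by have [D [_ _ DE]] := smoothing_twice_differentiable x;
  exact: (frechet_components DE).1.
Qed.

(* The Hessian of the smoothing is the average of the Hessians of [f] on the ball. *)
Lemma quad_hess_smoothing_le x w (M : R) :
  (forall y, eball x sigma y -> differentiable (grad f) y -> quad (hess f y) w <= M) ->
  quad (hess (ball_smoothing sigma f) x) w <= M.
Proof.
move=> hM; have [D [bD Dae DE]] := smoothing_twice_differentiable x.
have bDw i : ae_bounded P (fun u => w 0 i * dot (\row_j D i j u) w).
  by apply: ae_boundedZ; exact: ae_bounded_dot.
rewrite quad_jacobian (frechet_components DE).2.
have -> : dot (\row_i dot (\row_j E (D i j)) w) w =
    E (fun u => \sum_i w 0 i * dot (\row_j D i j u) w).
  rewrite expect_sum//; apply: eq_bigr => i _.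
  by rewrite mxE dot_expect// mulrC expectZ//; exact: ae_bounded_dot.
apply: expect_le_cst; first exact: ae_bounded_sum.
move: Dae (ae_differentiable_grad x); apply: filterS2 => u Du [xu du].
have := hM _ xu du; rewrite quad_jacobian (frechet_components Du).2.
by congr (_ <= _); apply: eq_bigr => i _; rewrite mxE mulrC.
Qed.

End smoothing_estimates.

(** The extrema are given as attained values [M w] and [m]; [n_gt0] makes the sphere nonempty, as a
    minimum requires. *)
Theorem proposition3p8 (R : realType) (n : nat) (n_gt0 : (0 < n)%N)
    (L eps1 eps2 delta : R) (L_gt0 : 0 < L) (eps1_gt0 : 0 < eps1)
    (eps2_gt0 : 0 < eps2) (delta_gt0 : 0 < delta)
    (x : 'rV[R]_n) (f : 'rV[R]_n -> R) (f_smooth : smooth L f) :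
  let eps_g := eps1 / 3 in
  let eps_H := eps2 in
  let sigma := Num.min delta (eps1 / (3 * L)) in
  let f_sigma := ball_smoothing sigma f in
  enorm (grad f_sigma x) <= eps_g ->
  - eps_H <= lambda_min (hess f_sigma x) ->
  enorm (grad f x) <= eps1 /\
  exists (M : 'rV[R]_n -> R) (m : R),
    [/\ forall w, esphere R n w ->
          is_max [set quad A w | A in goldstein_hessian delta f x] (M w),
        is_min [set M w | w in esphere R n] m &
        - eps2 <= m].
Proof.
move=> eps_g eps_H sigma fs gradfs lamfs.
have L0 := ltW L_gt0.
have sigma_gt0 : 0 < sigma by rewrite lt_min delta_gt0 divr_gt0// mulr_gt0.
have sigma_delta : sigma <= delta by rewrite ge_min lexx.
have Lsigma : L * sigma <= eps1 / 3.
  rewrite (@le_trans _ _ (L * (eps1 / (3 * L))))//.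
    by rewrite ler_wpM2l// ge_min lexx orbT.
  by rewrite (_ : L * _ = eps1 / 3)//; field; rewrite gt_eqF.
split.
  rewrite -(subrK (grad fs x) (grad f x)) (le_trans (enormD _ _))//.
  rewrite (le_trans (lerD (le_trans (grad_smoothing_dist sigma_gt0 L0 f_smooth x)
    Lsigma) gradfs))//.
  by rewrite /eps_g; lra.
(* Almost every point of the ball is one of twice differentiability, and a constant sequence makes
   its Hessian a limiting one. *)
have S0 : hessian_pairs f x delta !=set0.
  have [u [xu du]] := ae_exists (ae_differentiable_grad sigma_gt0 L0 f_smooth x).
  exists (x + sigma *: rV_of_tuple u, hess f (x + sigma *: rV_of_tuple u)).
  split => /=; first exact: le_trans xu sigma_delta.
  exists (fun=> x + sigma *: rV_of_tuple u); split; [|exact: cvg_cst|exact: cvg_cst].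
  by move=> _; split => //; exact: smooth_near_differentiable f_smooth _.
have /choice[M MP] := fun w => goldstein_max L0 f_smooth w S0.
have cM : continuous M.
  apply: (@continuous_quad_bound _ _ _ (n%:R * n%:R * (L * n%:R))) => [|u v].
    by rewrite !mulr_ge0.
  exact (goldstein_quad_dist L0 f_smooth (MP u).1 (MP v).1).
have [c] := EVT_min_rV (esphere_nonempty R n_gt0) (@compact_esphere R n)
  (continuous_subspaceT cM).
rewrite inE => c1 cmin; exists M, (M c); split => [w _||].
- exact: (MP w).1.
- split; first by exists c.
  by move=> _ [w w1 <-]; apply: cmin; rewrite inE.
(* At the minimizer [c], [lambda_min] is at most the form of the smoothed Hessian, an average over
   the ball of radius [sigma <= delta] of values at most [M c]. *)
- apply: (le_trans lamfs).
  have symH : (hess fs x)^T = hess fs x.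
    apply: hess_sym => [y|]; first exact: differentiable_smoothing L0 f_smooth y.
    exact: differentiable_grad_smoothing sigma_gt0 L0 f_smooth x.
  apply: (le_trans (lambda_min_le_quad n_gt0 symH c1)).
  apply: (quad_hess_smoothing_le sigma_gt0 L0 f_smooth) => y xy dy.
  by apply: (MP c).2 => //; exact: le_trans xy sigma_delta.
Qed.
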